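(* Let $(\mathsf{Gen},\mathsf{Sign},\mathsf{Ver})$ be a one-time oracle signature scheme with perfect completeness in the random oracle model for a message space $\mathcal{M}$, with a total of at most $q$ oracle queries, in which the verification algorithm asks at most $v$ oracle queries, where $v\le q/2$. Let $\lambda,\delta>0$ and suppose $|\mathcal{M}|\ge \binom{q}{v}/\lambda$. Then there is an adversary asking at most $O\!\left(\frac{q^2\binom{q}{v}}{\lambda\delta^2}\right)$ oracle queries that breaks the scheme with probability at least $1-\lambda-\delta$.
   Context: Random oracle: a uniformly random function $\{0,1\}^\ell\to\{0,1\}^\ell$ for each length $\ell$, accessible only by queries. Perfect completeness: for every oracle $\mathcal{O}$, every key pair $(SK,VK)$ output by $\mathsf{Gen}^{\mathcal{O}}$ with positive probability and every $\alpha\in\mathcal{M}$, $\mathsf{Ver}^{\mathcal{O}}(VK,\alpha,\mathsf{Sign}^{\mathcal{O}}(SK,\alpha))=1$. The total number of queries is counted over generating keys, signing one message and verifying that signature. Breaking the one-time scheme: the adversary receives $VK$, chooses a message $\alpha$ independently of $VK$, receives $\mathsf{Sign}^{\mathcal{O}}(SK,\alpha)$, queries the oracle, and outputs $(\alpha^*,\sigma^* )$ with $\alpha^*\ne\alpha$ and $\mathsf{Ver}^{\mathcal{O}}(VK,\alpha^*,\sigma^* )=1$; probabilities are over the oracle and the coins of key generation and the adversary. *)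

(* Defs.v *)
From HB Require Import structures.
From mathcomp Require Import all_boot all_order all_algebra.
From mathcomp Require Import all_classical all_reals all_analysis.

Set Implicit Arguments.
Unset Strict Implicit.
Unset Printing Implicit Defensive.

Import Order.TTheory GRing.Theory Num.Theory.
Import numFieldNormedType.Exports.

Local Open Scope classical_set_scope.
Local Open Scope card_scope.
Local Open Scope ring_scope.

Notation lenfun l := {ffun l.-tuple bool -> l.-tuple bool}.

Definition oracle := forall l : nat, lenfun l.

HB.instance Definition _ := gen_eqMixin oracle.
HB.instance Definition _ := gen_choiceMixin oracle.
HB.instance Definition _ :=
  isPointed.Build oracle (fun l => [ffun x : l.-tuple bool => x]).

Definition oracle_cylinders : set (set oracle) :=
  [set C | exists l (f : lenfun l), C = [set O : oracle | O l = f]].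

Definition oracleM := g_sigma_algebraType oracle_cylinders.

(* The maps O 0, O 1, ... are independent and each O l is uniform on the finite
   type of functions {0,1}^l -> {0,1}^l.  As the events below form a pi-system
   generating the sigma-algebra of [oracleM], this determines P. *)
Definition random_oracle (R : realType) (P : probability oracleM R) : Prop :=
  forall (n : nat) (f : oracle),
    P [set O | forall l, (l < n)%N -> O l = f l] =
    (\prod_(l < n) (#|{: lenfun l}|%:R)^-1)%:E.

(* Deterministic algorithms with oracle access, as decision trees: the only
   access to the oracle is through [Query]. *)
Inductive oalg (A : Type) : Type :=
| Ret of A
| Query (l : nat) (x : l.-tuple bool) (k : l.-tuple bool -> oalg A).

Arguments Ret {A}.
Arguments Query {A l}.

Fixpoint run (A : Type) (O : oracle) (a : oalg A) : A :=
  match a with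
  | Ret y => y
  | Query l x k => run O (k (O l x))
  end.

Fixpoint nqueries (A : Type) (O : oracle) (a : oalg A) : nat :=
  match a with
  | Ret _ => 0
  | Query l x k => (nqueries O (k (O l x))).+1
  end.

(* The coins of a probabilistic algorithm follow an arbitrary distribution on
   nat.  This loses no generality: queries have finitely many answers, so a
   decision tree is finite, and with countably many outputs there are countably
   many of them. *)
Record scheme (R : realType) (M SK VK Sig : Type) := Scheme {
  gen_coins : probability nat R ;
  gen : nat -> oalg (SK * VK) ;
  sign : SK -> M -> oalg Sig ;
  ver : VK -> M -> Sig -> oalg bool }.

Section Scheme.
Variables (R : realType) (M SK VK Sig : Type) (S : scheme R M SK VK Sig).

Definition perfectly_complete : Prop :=
  forall (O : oracle) (sk : SK) (vk : VK),
    (0 < gen_coins S [set r | run O (gen S r) = (sk, vk)])%E ->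
    forall m : M, run O (ver S vk m (run O (sign S sk m))) = true.

Definition total_queries_le (q : nat) : Prop :=
  forall (O : oracle) (r : nat), (0 < gen_coins S [set r])%E ->
  forall m : M,
    let: (sk, vk) := run O (gen S r) in
    let sigma := run O (sign S sk m) in
    (nqueries O (gen S r) + nqueries O (sign S sk m)
       + nqueries O (ver S vk m sigma) <= q)%N.

Definition ver_queries_le (v : nat) : Prop :=
  forall (O : oracle) (vk : VK) (m : M) (sigma : Sig),
    (nqueries O (ver S vk m sigma) <= v)%N.

End Scheme.

(* [adv_msg] sees neither the verification key nor the oracle, so the message
   is independent of the key. *)
Record adversary (R : realType) (M VK Sig : Type) := Adversary {
  adv_coins : probability nat R ;
  adv_msg : nat -> M ;
  adv_forge : nat -> VK -> Sig -> oalg (M * Sig) }.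

Section Attack.
Variables (R : realType) (M SK VK Sig : Type).
Variables (S : scheme R M SK VK Sig) (A : adversary R M VK Sig).

Definition adv_queries_le (B : R) : Prop :=
  forall (O : oracle) (s : nat) (vk : VK) (sigma : Sig),
    (nqueries O (adv_forge A s vk sigma))%:R <= B.

Definition breaks (s r : nat) (O : oracle) : Prop :=
  let: (sk, vk) := run O (gen S r) in
  let m := adv_msg A s in
  let sigma := run O (sign S sk m) in
  let: (m', sigma') := run O (adv_forge A s vk sigma) in
  m' <> m /\ run O (ver S vk m' sigma') = true.

Definition break_prob (P : probability oracleM R) : \bar R :=
  (adv_coins A \x (gen_coins S \x P))%E
    [set w | breaks w.1 w.2.1 w.2.2].

End Attack.

Definition card_at_least (R : realType) (M : Type) (x : R) : Prop :=
  exists2 n : nat, x <= n%:R & `I_n #<= [set: M].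

(* Existence of a random oracle: take the mixed-radix digits, with radices the
   cardinals of [lenfun 0], [lenfun 1], ..., of a uniform real in [0, 1[. *)
Section RandomOracleExists.
Variable R : realType.

Let N l := #|{: lenfun l}|.
Let D n := (\prod_(l < n) N l)%N.

Let N_gt0 l : (0 < N l)%N.
Proof. by apply/card_gt0P; exists [ffun x => x]. Qed.

Let D_gt0 n : (0 < D n)%N.
Proof. by rewrite prodn_gt0. Qed.

Let DS n : D n.+1 = (D n * N n)%N.
Proof. by rewrite /D big_ord_recr. Qed.

Let digit (u : R) l := (Num.truncn (u * (D l.+1)%:R) %% N l)%N.

Let X (u : R) : oracleM :=
  fun l => nth [ffun x => x] (enum {: lenfun l}) (digit u l).

Let X_eq (u : R) l (f : lenfun l) : X u l = f <-> digit u l = index f (enum {: lenfun l}).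
Proof.
have dlt : (digit u l < size (enum {: lenfun l}))%N.
  by rewrite -cardE ltn_mod N_gt0.
split=> [<-|E]; first by rewrite index_uniq ?enum_uniq.
by rewrite /X E nth_index // mem_enum.
Qed.

Let truncnS (u : R) n : 0 <= u ->
  (Num.truncn (u * (D n.+1)%:R) %/ N n)%N = Num.truncn (u * (D n)%:R).
Proof.
move=> u0; have h m : 0 <= u * (D m)%:R by rewrite mulr_ge0.
have Ngt0 : 0 < (N n)%:R :> R by rewrite ltr0n.
apply/esym/truncn_def.
have /andP[h1 h2] := truncn_itv (h n.+1).
set t := Num.truncn _ in h1 h2 *.
rewrite -(ler_pM2r Ngt0) -(ltr_pM2r Ngt0) -!mulrA -!natrM -DS; apply/andP; split.
  by apply: le_trans h1; rewrite ler_nat leq_divM.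
by apply: lt_le_trans h2 _; rewrite ler_nat ltn_ceil.
Qed.

Let Fixpoint idx (f : oracle) n : nat :=
  if n is m.+1 then (idx f m * N m + index (f m) (enum {: lenfun m}))%N else 0%N.

Let index_lt l (f : lenfun l) : (index f (enum {: lenfun l}) < N l)%N.
Proof. by rewrite [X in (_ < X)%N]cardE index_mem mem_enum. Qed.

Let idx_lt f n : (idx f n < D n)%N.
Proof.
elim: n => [|n IH] /=; first by rewrite /D big_ord0.
rewrite DS; apply: (@leq_trans ((idx f n).+1 * N n)); last by rewrite leq_mul2r IH orbT.
by rewrite mulSn addnC ltn_add2r index_lt.
Qed.

Let agreeP (f : oracle) (u : R) n : 0 <= u < 1 ->
  (forall l, (l < n)%N -> X u l = f l) <-> Num.truncn (u * (D n)%:R) = idx f n.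
Proof.
move=> /andP[u0 u1]; elim: n => [|n IH].
  split=> // _; rewrite /D big_ord0 mulr1 /=.
  by apply: truncn_def; rewrite u0.
have E := divn_eq (Num.truncn (u * (D n.+1)%:R)) (N n).
rewrite truncnS // -/(digit u n) in E.
split=> [h|].
  rewrite E /=; have -> : Num.truncn (u * (D n)%:R) = idx f n.
    by apply/IH => l ln; apply: h; exact: ltnW.
  by rewrite (X_eq u (f n)).1 //; apply: h.
rewrite {}E /= => E.
have [e1 e2] : Num.truncn (u * (D n)%:R) = idx f n /\
    digit u n = index (f n) (enum {: lenfun n}).
  have d1 : (digit u n < N n)%N by rewrite ltn_mod.
  split.
    by move: (congr1 (divn^~ (N n)) E); rewrite !divnMDl // !divn_small // !addn0.
  by move: (congr1 (modn^~ (N n)) E); rewrite !modnMDl !modn_small.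
move=> l; rewrite ltnS leq_eqVlt => /predU1P[->|ln]; first exact/X_eq.
by move/IH: e1; apply.
Qed.

Let mX : measurable_fun [set: measurableTypeR R] (X : measurableTypeR R -> oracleM).
Proof.
apply: (measurability oracle_cylinders (aT := measurableTypeR R) (rT := oracleM)) => // _ [_ [l [f ->]] <-].
rewrite setTI.
pose t (u : R) := Num.truncn (u * (D l.+1)%:R).
have D0 : 0 < (D l.+1)%:R :> R by rewrite ltr0n.
have mle k : measurable [set u : measurableTypeR R | (t u <= k)%N].
  suff -> : [set u | (t u <= k)%N] = `]-oo, k.+1%:R / (D l.+1)%:R[%classic.
    exact: measurable_itv.
  by apply/seteqP; split=> u; rewrite /= in_itv /= ltr_pdivlMr // truncn_le_nat.
have meq k : measurable [set u : measurableTypeR R | t u = k].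
  case: k => [|k].
    rewrite (_ : [set _ | _] = [set u | (t u <= 0)%N]) //.
    by apply/seteqP; split=> u /=; [move=> -> | rewrite leqn0 => /eqP].
  rewrite (_ : [set _ | _] = [set u | (t u <= k.+1)%N] `\` [set u | (t u <= k)%N]).
    exact: measurableD.
  apply/seteqP; split=> u /=; first by move=> ->; rewrite ltnn; split.
  by move=> [h1 /negP]; rewrite -ltnNge => h2; apply/eqP; rewrite eqn_leq h1.
pose K := [set k | (k %% N l)%N = index f (enum {: lenfun l})].
rewrite (_ : _ @^-1` _ = \bigcup_(k in K) [set u | t u = k]).
  by apply: bigcup_measurable => k _.
apply/seteqP; split=> u /=; first by move/X_eq => h; exists (t u).
by move=> [k /= h tk]; apply/X_eq; rewrite /digit -/(t u) tk h.
Qed.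

Let U01 : {measure set (measurableTypeR R) -> \bar R} :=
  mrestr (@lebesgue_measure R)
  (measurable_itv `[0%R, 1%R[ : measurable (`[0%R, 1%R[%classic : set (measurableTypeR R))).

Let U01_setT : U01 [set: measurableTypeR R] = 1%E.
Proof.
by rewrite /U01 /= /mrestr setTI lebesgue_measure_itv /= lte_fin ltr01 oppr0 adde0.
Qed.

Lemma random_oracle_exists : exists P : probability oracleM R, random_oracle P.
Proof.
pose mP := Measure_isProbability.Build _ _ _ U01 U01_setT.
pose P0 : probability (measurableTypeR R) R := HB.pack (Measure.sort U01) (Measure.class U01) mP.
pose X' : measurableTypeR R -> oracleM := X.
pose mmX := @isMeasurableFun.Build _ _ (measurableTypeR R) oracleM X' mX.
pose Xm : {mfun measurableTypeR R >-> oracleM} := HB.pack X' mmX.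
exists (distribution P0 Xm) => n f.
have D0 : 0 < (D n)%:R :> R by rewrite ltr0n.
have D0' : (D n)%:R != 0 :> R by rewrite gt_eqF.
transitivity (lebesgue_measure
    (`[(idx f n)%:R / (D n)%:R, (idx f n).+1%:R / (D n)%:R[%classic : set R)).
  rewrite /distribution /pushforward /= /U01 /mrestr; congr lebesgue_measure.
  apply/seteqP; split=> u /=; rewrite !in_itv /=.
    move=> [h u01]; have /andP[u0 _] := u01.
    move/(agreeP f n u01): h => /eqP.
    by rewrite truncn_eq ?mulr_ge0 // ler_pdivrMr // ltr_pdivlMr.
  rewrite ler_pdivrMr // ltr_pdivlMr // => h.
  have u01 : 0 <= u < 1.
    case/andP: h => h1 h2; apply/andP; split.
      by rewrite -(pmulr_lge0 _ D0); exact: le_trans h1.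
    rewrite -(ltr_pM2r D0) mul1r; apply: lt_le_trans h2 _.
    by rewrite ler_nat idx_lt.
  split=> //; apply/(agreeP f n u01); exact: truncn_def.
rewrite lebesgue_measure_itv /= lte_fin ltr_pM2r ?invr_gt0 // ltr_nat ltnSn.
rewrite -EFinD -mulrBl -natrB // subSnn mul1r /D natr_prod.
by rewrite prodfV.
Qed.

End RandomOracleExists.

(* Main.v *)
(* Fix messages alpha_1, ..., alpha_n.  For a run of key generation, let U_i be
   the queries of generating keys, signing alpha_i and verifying the signature,
   and V_i those of the verification alone.  Bollobas' inequality for the pairs
   (V_i, U_i \ V_i) shows that for all but 'C(q, v) indices i some j <> i has
   V_j disjoint from U_i \ V_i; so a fixed message alpha_i is good with
   probability at least 1 - lambda.

   Given the key and a signature on alpha_i, the adversary keeps asking every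
   query that belongs with conditional probability at least eps to the queries
   of the n runs together; as these number at most q n, about q n / eps queries
   suffice on average.  It then takes a fake run compatible with everything
   seen, and signs all alpha_j with the fake secret key, answering from the fake
   run on its set U_i and from the real oracle elsewhere.  Exchanging the real and the
   fake oracle outside the two sets U_i preserves the joint distribution, so up to
   an error q eps the hybrid run is as good as a genuine one; perfect
   completeness makes each hybrid signature valid in the hybrid oracle, and for a
   good pair (i, j) its verification cannot tell the hybrid oracle from the real
   one.  An averaging argument makes the choice of i and of the fake run
   deterministic. *)
From mathcomp Require Import all_boot all_order all_algebra.
From mathcomp Require Import zify.

Set Implicit Arguments.
Unset Strict Implicit.
Unset Printing Implicit Defensive.

Import Order.TTheory GRing.Theory Num.Theory.

(** * Bollobas' set-pair inequality *)

Section Bollobas.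
Local Open Scope nat_scope.

Lemma leq_bin_half (q a v : nat) : a <= v -> 2 * v <= q -> 'C(q, a) <= 'C(q, v).
Proof.
elim: v => [|v IH]; first by rewrite leqn0 => /eqP ->.
rewrite leq_eqVlt => /predU1P[-> //|]; rewrite ltnS => av vq.
apply: (leq_trans (IH av _)); first by lia.
rewrite -(@leq_pmul2l v.+1) // mul_bin_left leq_mul2r; apply/orP; right; lia.
Qed.

Lemma leq_bin_sub (q v a b : nat) :
  a <= v -> a + b <= q -> 2 * v <= q -> 'C(a + b, a) <= 'C(q, v).
Proof.
move=> av abq vq; apply: leq_trans (leq_bin_half av vq); exact: leq_bin2l.
Qed.

Variables (T J : finType).

(* Induction on the ground set: for each point x, discard the pairs with
   x in A and remove x from every B; the resulting inequalities, summed over x,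
   give #|X| times the claim. *)
Lemma bollobas_ground (X : {set T}) (A B : J -> {set T}) (I : {set J}) :
  (forall i, i \in I -> A i \subset X) ->
  (forall i, i \in I -> B i \subset X) ->
  (forall i, i \in I -> [disjoint A i & B i]) ->
  (forall i j, i \in I -> j \in I -> i != j -> ~~ [disjoint A j & B i]) ->
  (\sum_(i in I) ('C(#|A i| + #|B i|, #|A i|)%:R : rat)^-1 <= 1)%R.
Proof.
move Em : #|X| => m; elim: m => [|m IH] in X Em A B I *.
  move/cards0_eq: Em => -> sA sB dAB xAB.
  have [->|[i iI]] := set_0Vmem I; first by rewrite big_set0.
  have IE : I = [set i].
    apply/setP=> j; rewrite inE; have [->|ji] := eqVneq j i; first by rewrite iI.
    apply/negP=> jI; have := xAB _ _ iI jI; rewrite eq_sym => /(_ ji)/negP; apply.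
    by move: (sB _ iI); rewrite subset0 => /eqP ->; rewrite -setI_eq0 setI0.
  rewrite IE big_set1 (_ : #|B i| = 0) ?addn0 ?binn ?invr1 //.
  by apply/eqP; rewrite cards_eq0 -subset0 sB.
move=> sA sB dAB xAB.
(* An empty [B i] meets no other [A j], which forces [I = [set i]]. With this case settled, every
   [B i] has a point and [b.-1] below is a true predecessor. *)
case: (boolP [exists i in I, B i == set0]) => [/exists_inP[i iI /eqP Bi0]|Bn0].
  have IE : I = [set i].
    apply/setP=> j; rewrite inE; have [->|ji] := eqVneq j i; first by rewrite iI.
    apply/negP=> jI; have := xAB _ _ iI jI; rewrite eq_sym => /(_ ji)/negP; apply.
    by rewrite Bi0 -setI_eq0 setI0.
  by rewrite IE big_set1 Bi0 cards0 addn0 binn invr1.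
have step x : x \in X ->
  (\sum_(i in I | x \notin A i)
      ('C(#|A i| + #|B i :\ x|, #|A i|)%:R : rat)^-1 <= 1)%R.
  move=> xX; rewrite -big_set /=.
  apply: (IH (X :\ x)) => [|i|i|i|i j].
  - by move: (cardsD1 x X); rewrite xX Em add1n => -[<-].
  - by rewrite inE => /andP[iI xi]; rewrite subsetD1 sA.
  - by rewrite inE => /andP[iI xi]; rewrite setSD ?sB.
  - rewrite inE => /andP[iI xi]; apply: disjointWr (dAB _ iI); exact: subsetDl.
  - rewrite !inE => /andP[iI xi] /andP[jI xj] ij.
    have := xAB _ _ iI jI ij; apply: contra.
    rewrite -!setI_eq0 => /eqP E; apply/eqP/setP => y; rewrite !inE.
    move/setP/(_ y): E; rewrite !inE; case: eqVneq => //= -> _.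
    by rewrite (negbTE xj).
have sumX : (\sum_(x in X) \sum_(i in I | x \notin A i)
      ('C(#|A i| + #|B i :\ x|, #|A i|)%:R : rat)^-1 <= m.+1%:R)%R.
  rewrite -Em -sum1_card natr_sum; apply: ler_sum => x; exact: step.
have m0 : (0 < (m.+1%:R : rat))%R by rewrite ltr0n.
rewrite -(ler_pM2l m0) mulr1; apply: le_trans sumX.
rewrite (exchange_big_dep (mem I)) /=; last by move=> x i _ /andP[].
rewrite mulr_sumr; apply: ler_sum => i iI.
rewrite (bigID (mem (B i))) /=.
set a := #|A i|; set b := #|B i|.
have abX : #|A i :|: B i| = a + b.
  by rewrite cardsU (_ : _ :&: _ = set0) ?cards0 ?subn0 //; apply/eqP; rewrite setI_eq0 dAB.
have b0 : 0 < b.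
  rewrite card_gt0; move/exists_inPn: Bn0; exact.
have c0 : (0 < ('C(a + b, a)%:R : rat))%R by rewrite ltr0n bin_gt0 leq_addr.
have c1 : (0 < ('C(a + b.-1, a)%:R : rat))%R by rewrite ltr0n bin_gt0 leq_addr.
rewrite (eq_bigr (fun=> ('C(a + b.-1, a)%:R : rat)^-1)%R); last first.
  by move=> x /andP[_ xB]; rewrite /b (cardsD1 x (B i)) xB.
rewrite [X in (_ <= _ + X)%R](eq_bigr (fun=> ('C(a + b, a)%:R : rat)^-1)%R); last first.
  move=> x /andP[_ xB]; rewrite /b (cardsD1 x (B i)) (negbTE xB) add0n //.
rewrite !sumr_const.
rewrite [X in (_ *+ X + _)%R](_ : _ = b); last first.
  apply: eq_card => x; rewrite [LHS]unfold_in iI /=.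
  case xB: (x \in B i); rewrite ?andbF // (subsetP (sB _ iI)) // andbT.
  by rewrite (disjointFl (dAB _ iI)).
rewrite [X in (_ <= _ + _ *+ X)%R](_ : _ = m.+1 - (a + b)); last first.
  rewrite -abX -Em -cardsDS; last by rewrite subUset sA // sB.
  by apply: eq_card => x; rewrite [LHS]unfold_in !inE iI /= negb_or; case: (_ \in X); rewrite ?andbF ?andbT.
have abm : a + b <= m.+1.
  by rewrite -abX -Em; apply: subset_leq_card; rewrite subUset sA // sB.
(* Pair [i] is counted [b] times with weight [1 / 'C(a + b - 1, a)] and [m + 1 - (a + b)] times with
   weight [1 / 'C(a + b, a)]; this identity makes the total [(m + 1) / 'C(a + b, a)]. *)
have E : ((a + b)%:R * 'C(a + b.-1, a)%:R = b%:R * 'C(a + b, a)%:R :> rat)%R.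
  rewrite -!natrM; congr (_%:R)%R.
  have := mul_bin_down (a + b) a; rewrite -addnBAC // subnn add0n => <-.
  by congr (_ * 'C(_, _)); lia.
rewrite -!(mulr_natl (_^-1)) natrB //.
rewrite (_ : (b%:R / _)%R = ((a + b)%:R / 'C(a + b, a)%:R)%R :> rat); last first.
  by apply/eqP; rewrite eqr_div ?lt0r_neq0 // E.
by rewrite -mulrDl addrC subrK.
Qed.

(** Under these size bounds each summand of the inequality is at least [1 / 'C(q, v)]. *)
Lemma bollobas_card (A B : J -> {set T}) (I : {set J}) (q v : nat) :
  2 * v <= q ->
  (forall i, i \in I -> #|A i| <= v) ->
  (forall i, i \in I -> #|A i| + #|B i| <= q) ->
  (forall i, i \in I -> [disjoint A i & B i]) ->
  (forall i j, i \in I -> j \in I -> i != j -> ~~ [disjoint A j & B i]) ->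
  #|I| <= 'C(q, v).
Proof.
move=> vq Av ABq dAB xAB.
have C0 : (0 < ('C(q, v)%:R : rat))%R by rewrite ltr0n bin_gt0; lia.
have sT (Y : {set T}) : Y \subset [set: T] by exact: subsetT.
have := bollobas_ground (fun i _ => sT (A i)) (fun i _ => sT (B i)) dAB xAB.
have le : (#|I|%:R * ('C(q, v)%:R)^-1 <=
    \sum_(i in I) ('C(#|A i| + #|B i|, #|A i|)%:R : rat)^-1)%R.
  rewrite mulr_natl -sumr_const; apply: ler_sum => i iI.
  rewrite lef_pV2 ?posrE ?ltr0n ?bin_gt0 ?leq_addr //; last by lia.
  by rewrite ler_nat leq_bin_sub ?Av ?ABq.
by move=> /(le_trans le); rewrite ler_pdivrMr // mul1r ler_nat.
Qed.

End Bollobas.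

From mathcomp Require Import all_classical all_reals all_analysis.
From mathcomp Require Import ring lra.
Require Import Defs.

(** * Query traces, composition and locality of decision trees *)

Section DecisionTrees.
Local Open Scope nat_scope.

Definition point := {l : nat & l.-tuple bool}.

Definition pt (l : nat) (x : l.-tuple bool) : point := Tagged (fun l => l.-tuple bool) x.

Definition ask (O : oracle) (u : point) : (tag u).-tuple bool := O (tag u) (tagged u).

Fixpoint queries (A : Type) (O : oracle) (t : oalg A) : seq point :=
  if t is Query l x k then pt x :: queries O (k (O l x)) else [::].

Fixpoint obind (A B : Type) (t : oalg A) (f : A -> oalg B) : oalg B :=
  match t with
  | Ret y => f y
  | Query l x k => Query x (fun a => obind (k a) f)
  end.

(** A strict bound on query lengths over all branches, hence the [.+1]; it is finite because every
    query has finitely many answers. *)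
Fixpoint maxlen (A : Type) (t : oalg A) : nat :=
  if t is Query l x k then maxn l.+1 (\max_(a : l.-tuple bool) maxlen (k a)) else 0.

Definition agree_below (N : nat) (O O' : oracle) := forall l, l < N -> O l = O' l.

Definition agree_on (s : seq point) (O O' : oracle) := {in s, forall u, ask O u = ask O' u}.

Definition patch (s : seq point) (O O' : oracle) : oracle :=
  fun l => [ffun x => if pt x \in s then O l x else O' l x].

(** Runs [t] in a patched oracle with access to [O'] alone: the answers on [s] are hard-wired into
    the tree and cost no query. *)
Fixpoint override (A : Type) (s : seq point) (O : oracle) (t : oalg A) : oalg A :=
  match t with
  | Ret y => Ret y
  | Query l x k => if pt x \in s then override s O (k (O l x))
                   else Query x (fun a => override s O (k a))
  end.

Lemma size_queries A O (t : oalg A) : size (queries O t) = nqueries O t.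
Proof. by elim: t => //= l x k IH; rewrite IH. Qed.

Lemma run_bind A B O (t : oalg A) (f : A -> oalg B) :
  run O (obind t f) = run O (f (run O t)).
Proof. by elim: t => //= l x k IH; rewrite IH. Qed.

Lemma queries_bind A B O (t : oalg A) (f : A -> oalg B) :
  queries O (obind t f) = queries O t ++ queries O (f (run O t)).
Proof. by elim: t => //= l x k IH; rewrite IH. Qed.

Lemma nqueries_bind A B O (t : oalg A) (f : A -> oalg B) :
  nqueries O (obind t f) = nqueries O t + nqueries O (f (run O t)).
Proof. by rewrite -!size_queries queries_bind size_cat. Qed.

Lemma maxlen_bind A B (t : oalg A) (f : A -> oalg B) :
  maxlen t <= maxlen (obind t f).
Proof.
elim: t => //= l x k IH; rewrite geq_max leq_maxl /=; apply/bigmax_leqP => a _.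
by apply: leq_trans (IH a) _; rewrite leq_max; apply/orP; right; exact: leq_bigmax.
Qed.

Lemma maxlen_bind_run A B O (t : oalg A) (f : A -> oalg B) :
  maxlen (f (run O t)) <= maxlen (obind t f).
Proof.
elim: t => //= l x k IH.
by apply: leq_trans (IH _) _; rewrite leq_max; apply/orP; right; exact: leq_bigmax.
Qed.

Lemma agree_queries A O O' (t : oalg A) :
  agree_on (queries O t) O O' -> run O t = run O' t /\ queries O t = queries O' t.
Proof.
elim: t => //= l x k IH h.
have E : O l x = O' l x by apply: (h (pt x)); rewrite mem_head.
have [|-> ->] := IH (O l x); last by rewrite E.
by move=> u us; apply: h; rewrite in_cons us orbT.
Qed.

Lemma tag_queries_lt A O (t : oalg A) u : u \in queries O t -> tag u < maxlen t.
Proof.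
elim: t => //= l x k IH; rewrite in_cons => /predU1P[->|/IH h]; rewrite leq_max ?leqnn //.
by apply/orP; right; apply: leq_trans h _; exact: leq_bigmax.
Qed.

(** A semantic substitute for a bound on [maxlen]: under [obind], only continuations at outputs that
    some oracle produces have to be examined. *)
Definition local (N : nat) A (t : oalg A) :=
  forall O O', agree_below N O O' -> run O t = run O' t.

Lemma local_maxlen N A (t : oalg A) : maxlen t <= N -> local N t.
Proof.
move=> tN O O' h; apply: (proj1 (agree_queries _)) => u /tag_queries_lt ut.
by rewrite /ask h // (leq_trans ut).
Qed.

Lemma local_bind N A B (t : oalg A) (f : A -> oalg B) :
  local N t -> (forall O, local N (f (run O t))) -> local N (obind t f).
Proof. by move=> ht hf O O' h; rewrite !run_bind -(ht _ _ h); exact: hf. Qed.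

Lemma local_query N A l (x : l.-tuple bool) (k : _ -> oalg A) :
  l < N -> (forall a, local N (k a)) -> local N (Query x k).
Proof. by move=> lN hk O O' h /=; rewrite (h l) //; exact: hk. Qed.

Lemma ask_patch s O O' u : ask (patch s O O') u = if u \in s then ask O u else ask O' u.
Proof. by case: u => l x; rewrite /ask /= ffunE. Qed.

Lemma eq_oracle O O' : (forall u, ask O u = ask O' u) -> O = O'.
Proof. by move=> h; apply: functional_extensionality_dep => l; apply/ffunP => x; exact: (h (pt x)). Qed.

Lemma run_override A s O O' (t : oalg A) :
  run O' (override s O t) = run (patch s O O') t.
Proof. by elim: t => //= l x k IH; rewrite ffunE; case: ifP => _ /=; rewrite IH. Qed.

Lemma nqueries_override A s O O' (t : oalg A) :
  nqueries O' (override s O t) <= nqueries (patch s O O') t.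
Proof.
elim: t => //= l x k IH; rewrite ffunE; case: ifP => _ /=; last by rewrite ltnS IH.
by rewrite ltnW // ltnS IH.
Qed.

Lemma local_override N A s O (t : oalg A) : local N t -> local N (override s O t).
Proof.
move=> ht O1 O2 h; rewrite !run_override; apply: ht => l lN.
by apply/ffunP => x; rewrite !ffunE h.
Qed.

End DecisionTrees.

(** * Finite truncations of oracles *)

Section Truncation.
Local Open Scope nat_scope.
Variable N : nat.

Definition tables := {dffun forall l : 'I_N, lenfun l}.

(** A common default from length [N] on makes a patch of two extensions an extension again. *)
Definition extend (w : tables) : oracle := fun l =>
  if (l < N) =P true is ReflectT h then w (Ordinal h) else [ffun x => x].

Definition truncate (O : oracle) : tables := [ffun l : 'I_N => O l].

Lemma extend_lt (w : tables) (l : 'I_N) : extend w l = w l.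
Proof.
case: l => l lN; rewrite /extend /=; case: eqP => [h|]; last by rewrite lN.
by rewrite (bool_irrelevance h lN).
Qed.

Lemma extend_ge (w : tables) l : N <= l -> extend w l = [ffun x => x].
Proof. by move=> Nl; rewrite /extend; case: eqP => // lN; lia. Qed.

Lemma truncateK : cancel extend truncate.
Proof. by move=> w; apply/ffunP => l; rewrite ffunE extend_lt. Qed.

Lemma extend_truncate (O : oracle) : agree_below N (extend (truncate O)) O.
Proof. by move=> l lN; have /= -> := extend_lt (truncate O) (Ordinal lN); rewrite ffunE. Qed.

Lemma extend_patch s (w w' : tables) :
  extend (truncate (patch s (extend w) (extend w'))) = patch s (extend w) (extend w').
Proof.
apply: functional_extensionality_dep => l.
have [lN|Nl] := ltnP l N; first by rewrite extend_truncate.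
by rewrite extend_ge //; apply/ffunP => x; rewrite [in RHS]ffunE !extend_ge ?if_same.
Qed.

End Truncation.

(** * Probabilities of events that depend on finitely many tables *)

Section LocalEvents.
Local Open Scope classical_set_scope.
Local Open Scope ring_scope.

Lemma measure_finType_bigcup (R : realType) (d : measure_display)
    (T : measurableType d) (mu : {measure set T -> \bar R}) (I : finType)
    (D : pred I) (F : I -> set T) :
  trivIset [set i | D i] F -> (forall i, D i -> measurable (F i)) ->
  mu (\bigcup_(i in [set i | D i]) F i) = (\sum_(i | D i) mu (F i))%E.
Proof.
move=> tF mF; rewrite measure_fin_bigcup //; last exact: finite_finset.
rewrite (_ : [set i | D i] = [set` enum D]).
  by rewrite -fsbig_seq ?enum_uniq // big_enum.
by apply/seteqP; split=> i /=; rewrite mem_enum.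
Qed.

Variables (R : realType) (P : probability oracleM R).

Definition cylinder N (f : oracle) : set oracleM := [set O | agree_below N O f].

Lemma measurable_cylinder N f : measurable (cylinder N f).
Proof.
rewrite (_ : cylinder N f = \bigcap_(l in [set l | (l < N)%N]) [set O : oracleM | O l = f l]).
  apply: bigcap_measurableType => l _; apply: sub_sigma_algebra.
  by exists l, (f l).
by apply/seteqP; split=> O h l; exact: h.
Qed.

Definition local_event N (Q : set oracleM) :=
  forall O O' : oracle, agree_below N O O' -> Q O -> Q O'.

Lemma local_eventE N (Q : set oracleM) : local_event N Q ->
  Q = \bigcup_(w in [set w : tables N | `[< Q (extend w) >]]) cylinder N (extend w).
Proof.
move=> hQ; apply/seteqP; split=> [f Qf | f [w /= /asboolP Qw h]].
  exists (truncate N f) => /=; last by move=> l lN; rewrite extend_truncate.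
  by apply/asboolP; apply: hQ Qf => l lN; rewrite extend_truncate.
by apply: hQ Qw => l lN; rewrite h.
Qed.

Lemma measurable_local_event N (Q : set oracleM) : local_event N Q -> measurable Q.
Proof.
move=> hQ; rewrite (local_eventE hQ); apply: fin_bigcup_measurable => [|w _]; first exact: finite_finset.
exact: measurable_cylinder.
Qed.

(** A local event is a finite disjoint union of cylinders of equal probability [c]; the sure event
    then identifies [c] as the inverse of the number of tables. *)
Lemma local_event_prob N (Q : set oracleM) : random_oracle P -> local_event N Q ->
  P Q = (#|{: tables N}|%:R^-1 * \sum_(w : tables N) (`[< Q (extend w) >])%:R)%:E.
Proof.
move=> hP hQ.
pose c := (\prod_(l < N) (#|{: lenfun l}|%:R)^-1 : R).
have E (Q' : set oracleM) : local_event N Q' ->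
    P Q' = (c * \sum_(w : tables N) (`[< Q' (extend w) >])%:R)%:E.
  move=> hQ'; rewrite {1}(local_eventE hQ') measure_finType_bigcup.
  - rewrite (eq_bigr (fun=> c%:E)) => [|w _]; last exact: hP.
    rewrite sumEFin; congr (_%:E); rewrite big_mkcond mulr_sumr.
    by apply: eq_bigr => w _; case: asboolP; rewrite ?mulr1 ?mulr0.
  - move=> w w' _ _ [f [h h']]; apply: (can_inj (@truncateK N)).
    apply: functional_extensionality_dep => l.
    have [lN|Nl] := ltnP l N; first by rewrite -h // -h'.
    by rewrite !extend_ge.
  - by move=> w _; exact: measurable_cylinder.
have /E : local_event N setT by [].
rewrite probability_setT => -[].
rewrite (eq_bigr (fun=> 1)) => [|w _]; last by rewrite asboolT.
rewrite sumr_const => /esym cE; rewrite E //; congr (_ * _)%:E.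
have N0 : #|{: tables N}|%:R != 0 :> R.
  by apply/eqP => N0; move: cE; rewrite N0 mulr0 => /eqP; rewrite eq_sym oner_eq0.
by apply: (mulIf N0); rewrite cE mulVf.
Qed.

End LocalEvents.

(** * Honest runs on the fixed messages, and good indices *)

Section Experiment.
Local Open Scope nat_scope.
Variables (R : realType) (M SK VK Sig : Type) (S : scheme R M SK VK Sig).
Variables (n : nat) (alpha : 'I_n -> M).

Definition weight (r : nat) : R := fine (gen_coins S [set r]%classic).

Lemma weight_ge0 r : (0 <= weight r)%R.
Proof. exact: fine_ge0. Qed.

Lemma weightE r : gen_coins S [set r]%classic = (weight r)%:E.
Proof. by rewrite fineK ?fin_num_measure. Qed.

(** The output is discarded: the tree serves to collect the queries of a whole honest run and to
    bound their lengths. *)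
Definition experiment (r : nat) (j : 'I_n) : oalg unit :=
  obind (gen S r) (fun kp =>
  obind (sign S kp.1 (alpha j)) (fun sg =>
  obind (ver S kp.2 (alpha j) sg) (fun=> Ret tt))).

Section Outcome.
Variables (r : nat) (O : oracle).

Definition skey : SK := (run O (gen S r)).1.
Definition vkey : VK := (run O (gen S r)).2.
Definition sig (j : 'I_n) : Sig := run O (sign S skey (alpha j)).
Definition ver_points (j : 'I_n) : seq point :=
  queries O (ver S vkey (alpha j) (sig j)).
Definition all_points (j : 'I_n) : seq point := queries O (experiment r j).
Definition run_points : seq point := flatten [seq all_points j | j <- enum 'I_n].

Lemma all_pointsE j : all_points j =
  queries O (gen S r) ++ queries O (sign S skey (alpha j)) ++ ver_points j.
Proof. by rewrite /all_points !queries_bind /= cats0. Qed.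

Lemma ver_points_sub j : {subset ver_points j <= all_points j}.
Proof. by move=> u h; rewrite all_pointsE !mem_cat h !orbT. Qed.

Lemma all_points_sub j : {subset all_points j <= run_points}.
Proof. by move=> u h; apply/flatten_mapP; exists j => //; rewrite mem_enum. Qed.

End Outcome.

Lemma agree_outcome r O O' j : agree_on (all_points r O j) O O' ->
  [/\ skey r O = skey r O', vkey r O = vkey r O', sig r O j = sig r O' j,
      ver_points r O j = ver_points r O' j & all_points r O j = all_points r O' j].
Proof.
move=> h; have [_ Eall] := agree_queries h.
have hg : agree_on (queries O (gen S r)) O O'.
  by move=> u uq; apply: h; rewrite all_pointsE mem_cat uq.
have [Eg _] := agree_queries hg.
have Es : skey r O = skey r O' by rewrite /skey Eg.
have Ev : vkey r O = vkey r O' by rewrite /vkey Eg.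
have hs : agree_on (queries O (sign S (skey r O) (alpha j))) O O'.
  by move=> u uq; apply: h; rewrite all_pointsE !mem_cat uq orbT.
have [Esg _] := agree_queries hs.
have Esig : sig r O j = sig r O' j by rewrite /sig Esg Es.
split=> //; rewrite /ver_points -Ev -Esig; apply: (proj2 (agree_queries _)) => u uq.
by apply: h; exact: ver_points_sub.
Qed.

Lemma tag_run_points_lt N r O u : (forall j, maxlen (experiment r j) <= N) ->
  u \in run_points r O -> tag u < N.
Proof.
move=> hN /flatten_mapP[j _ /tag_queries_lt h]; exact: leq_trans h (hN j).
Qed.

Variables (q v : nat).
Hypothesis complete : perfectly_complete S.
Hypothesis totq : total_queries_le S q.
Hypothesis verq : ver_queries_le S v.
Hypothesis vq : 2 * v <= q.

Lemma size_all_points r O j : (0 < weight r)%R -> size (all_points r O j) <= q.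
Proof.
move=> r0; have := @totq O r; rewrite weightE lte_fin => /(_ r0 (alpha j)).
rewrite all_pointsE !size_cat !size_queries /ver_points /sig /vkey /skey.
by case: (run O (gen S r)) => sk vk /=; rewrite addnA.
Qed.

Lemma nqueries_sign r O j :
  (0 < weight r)%R -> nqueries O (sign S (skey r O) (alpha j)) <= q.
Proof.
move=> /(@size_all_points _ O j); apply: leq_trans.
by rewrite -size_queries all_pointsE !size_cat addnCA leq_addr.
Qed.

Lemma size_run_points r O : (0 < weight r)%R -> size (run_points r O) <= q * n.
Proof.
move=> r0; rewrite size_flatten /shape sumnE big_map big_map big_enum /=.
apply: (@leq_trans (\sum_(j < n) q)); last by rewrite sum_nat_const card_ord mulnC.
by apply: leq_sum => j _; exact: size_all_points.
Qed.

Lemma size_ver_points r O j : size (ver_points r O j) <= v.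
Proof. by rewrite size_queries. Qed.

Lemma complete_weight r O j : (0 < weight r)%R ->
  run O (ver S (vkey r O) (alpha j) (sig r O j)) = true.
Proof.
move=> r0; apply: complete.
apply: (@lt_le_trans _ _ (gen_coins S [set r]%classic)).
  by rewrite weightE lte_fin.
apply: le_measure; rewrite ?inE // => r' /= ->.
by rewrite /skey /vkey; case: (run _ _).
Qed.

(* Forging on [alpha j] after seeing a signature on [alpha i] is possible when
   the verification queries for [j] avoid the hidden queries for [i]. *)
Definition good (r : nat) (O : oracle) (i : 'I_n) : bool :=
  [exists j, (j != i) &&
    all (fun u => (u \in all_points r O i) ==> (u \in ver_points r O i)) (ver_points r O j)].

Lemma card_index_set (s t : seq point) (Q : pred point) : uniq s ->
  {in s, forall u, Q u -> u \in t} ->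
  #|[set k : 'I_(size s) | Q (tnth (in_tuple s) k)]| <= size t.
Proof.
move=> us h; rewrite cardE.
rewrite -(size_map (tnth (in_tuple s))); apply: uniq_leq_size.
  rewrite map_inj_uniq ?enum_uniq //; exact/tuple_uniqP.
move=> u /mapP[k]; rewrite mem_enum inE => Qk ->; apply: h => //; exact: mem_tnth.
Qed.

Lemma card_bad r O : (0 < weight r)%R -> #|[set i | ~~ good r O i]| <= 'C(q, v).
Proof.
(* The inequality needs a finite ground type, whereas [point] is infinite; positions in the
   duplicate-free list of run queries take its place. *)
move=> r0; pose s := undup (run_points r O).
have us : uniq s := undup_uniq _.
pose A i := [set k : 'I_(size s) | tnth (in_tuple s) k \in ver_points r O i]%SET.
pose B i := [set k : 'I_(size s) | (tnth (in_tuple s) k \in all_points r O i) &&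
                                   (tnth (in_tuple s) k \notin ver_points r O i)]%SET.
have dAB i : [disjoint A i & B i].
  by rewrite -setI_eq0; apply/eqP/setP => k; rewrite !inE; case: (_ \in ver_points _ _ _); rewrite ?andbF.
apply: (@bollobas_card _ _ A B) => // [i _|i _|i j iI jI ij].
- by apply: leq_trans (size_ver_points r O i); exact: card_index_set.
- have -> : #|A i| + #|B i| = #|A i :|: B i|.
    by rewrite cardsU; move: (dAB i); rewrite -setI_eq0 => /eqP ->; rewrite cards0 subn0.
  apply: leq_trans (size_all_points O i r0).
  rewrite (_ : A i :|: B i =
      [set k : 'I_(size s) | tnth (in_tuple s) k \in all_points r O i]%SET).
    exact: card_index_set.
  apply/setP => k; rewrite !inE.
  by case: (boolP (_ \in ver_points _ _ _)) => [/ver_points_sub ->|]; rewrite ?andbT.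
- move: iI; rewrite inE negb_exists => /forallP/(_ j); rewrite eq_sym ij /=.
  move=> /allPn[u uj]; rewrite negb_imply => /andP[ui uni].
  have us' : u \in s by rewrite mem_undup; apply/all_points_sub/ui.
  have /tnthP[k uE] : u \in in_tuple s by [].
  rewrite -setI_eq0; apply/set0Pn; exists k; rewrite !inE -uE uj ui.
  exact: uni.
Qed.

End Experiment.

Lemma has_le_sum (R : numDomainType) (X : Type) (a : pred X) (s : seq X) :
  ((has a s)%:R <= \sum_(u <- s) (a u)%:R :> R)%R.
Proof.
elim: s => [|u s IH]; rewrite ?big_nil ?big_cons //=; case: (a u) => //=.
  by rewrite lerDl sumr_ge0.
by rewrite add0r.
Qed.

(* A fact [Tagged _ (x, a)] records the answer [a] to the query [x]. *)
Definition fact := {l : nat & (l.-tuple bool * l.-tuple bool)%type}.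

Definition mkfact l (x a : l.-tuple bool) : fact :=
  Tagged (fun l => (l.-tuple bool * l.-tuple bool)%type) (x, a).

Definition known (D : seq fact) : seq point := [seq pt (tagged e).1 | e <- D].

Definition consistent (D : seq fact) (O : oracle) : bool :=
  all (fun e => O (tag e) (tagged e).1 == (tagged e).2) D.

Lemma consistent_known D O O' :
  consistent D O -> consistent D O' -> agree_on (known D) O O'.
Proof.
move=> /allP h /allP h' u /mapP[e eD ->]; rewrite /ask /=.
by rewrite (eqP (h _ eD)) (eqP (h' _ eD)).
Qed.

Lemma agree_consistent D O O' :
  agree_on (known D) O O' -> consistent D O -> consistent D O'.
Proof.
move=> h /allP hO; apply/allP => e eD; rewrite -(eqP (hO _ eD)); apply/eqP/esym.
by apply: (h (pt (tagged e).1)); apply/mapP; exists e.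
Qed.

(** * Weighted samples and the exchange of two oracles *)

Section Attack.
Local Open Scope ring_scope.
Variables (R : realType) (M SK VK Sig : Type) (S : scheme R M SK VK Sig).
Variables (n : nat) (alpha : 'I_n -> M) (q v K N : nat).
Hypothesis alpha_inj : injective alpha.
Hypothesis complete : perfectly_complete S.
Hypothesis totq : total_queries_le S q.
Hypothesis verq : ver_queries_le S v.
Hypothesis vq : (2 * v <= q)%N.
Hypothesis explen : forall r j, (r < K)%N -> (maxlen (experiment S alpha r j) <= N)%N.
Variables (i : 'I_n) (eps : R).
Hypothesis eps_gt0 : 0 < eps.
Hypothesis eps_le1 : eps <= 1.

Local Notation sample := ('I_K * tables N)%type.
Local Notation orc x := (extend x.2).
Local Notation wt x := (weight S (x.1 : 'I_K)).
Local Notation U x := (all_points S alpha x.1 (orc x) i).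
Local Notation T x := (run_points S alpha x.1 (orc x)).
Local Notation V x j := (ver_points S alpha x.1 (orc x) j).

Implicit Types x y : sample.

(** An unnormalised probability over coins below [K] and uniform tables; conditional probabilities
    become comparisons of masses without division. *)
Definition mass (Q : pred sample) : R := \sum_(x | Q x) wt x.

Lemma mass_ge0 Q : 0 <= mass Q.
Proof. by apply: sumr_ge0 => x _; exact: weight_ge0. Qed.

Lemma le_mass (Q Q' : pred sample) : (forall x, Q x -> Q' x) -> mass Q <= mass Q'.
Proof.
move=> h; rewrite /mass big_mkcond [leRHS]big_mkcond; apply: ler_sum => x _.
case: ifP => [/h ->//|_]; case: ifP => // _; exact: weight_ge0.
Qed.

Lemma mass_cond (C Q : pred sample) :
  mass (fun x => C x && Q x) = \sum_(x | C x) wt x * (Q x)%:R.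
Proof.
by rewrite /mass big_mkcondr; apply: eq_bigr => x _; case: (Q x); rewrite ?mulr1 ?mulr0.
Qed.

(* Exchange two oracles outside the queries of the two runs; [blend x x'] is the
   second component of the exchanged pair and [blend x' x] the first. *)
Definition blend (x x' : sample) : sample :=
  (x'.1, truncate N (patch (U x ++ U x') (orc x') (orc x))).

Definition exchange (p : sample * sample) : sample * sample :=
  (blend p.2 p.1, blend p.1 p.2).

Lemma orc_blend x x' : orc (blend x x') = patch (U x ++ U x') (orc x') (orc x).
Proof. exact: extend_patch. Qed.

Lemma agree_blend x x' : agree_on (U x') (orc x') (orc (blend x x')).
Proof. by move=> u ux'; rewrite orc_blend ask_patch mem_cat ux' orbT. Qed.

Lemma blend_points x x' : U (blend x x') = U x'.
Proof. by have [_ _ _ _ <-] := agree_outcome (@agree_blend x x'). Qed.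

(** Blending preserves the query sets [U] of both runs, so the second exchange acts at the same
    points and undoes the first. *)
Lemma exchangeK : involutive exchange.
Proof.
have K1 x x' : blend (blend x' x) (blend x x') = x'.
  rewrite {1}/blend /= !blend_points !orc_blend.
  rewrite [X in (_, truncate _ X)](_ : _ = orc x') ?truncateK; first by case: x'.
  apply: eq_oracle => u; rewrite !ask_patch !mem_cat.
  by case: (u \in U x); case: (u \in U x').
by move=> [x x']; rewrite /exchange /= !K1.
Qed.

(** * Heavy queries and the existence of a good fake run *)

Section View.
Variables (vk : VK) (sg : Sig).

(** Positivity of the weight excludes coins for which completeness or the total query bound may
    fail. *)
Definition compatible (D : seq fact) (x : sample) : bool :=
  [&& 0 < wt x,
      `[< vkey S x.1 (orc x) = vk /\ sig S alpha x.1 (orc x) i = sg >] &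
      consistent D (orc x)].

Lemma compatible_blend D x x' :
  compatible D x -> compatible D x' -> compatible D (blend x x').
Proof.
move=> /and3P[_ _ cx] /and3P[w' /asboolP[E1 E2] cx']; apply/and3P; split=> //.
  by apply/asboolP; rewrite -E1 -E2; have [_ -> -> _ _] := agree_outcome (@agree_blend x x').
apply: (agree_consistent _ cx') => u uD; rewrite orc_blend ask_patch.
by case: ifP => // _; exact: (consistent_known cx' cx).
Qed.

(** The positivity clause prevents every unknown point from being heavy when no sample is
    compatible. *)
Definition heavy (D : seq fact) (u : point) : bool :=
  [&& u \notin known D, 0 < mass (compatible D) &
      eps * mass (compatible D) <= mass (fun x => compatible D x && (u \in T x))].

(** Here [x] is the real run and [x'] the fake one, whose secret key signs in the hybrid oracle. *)
Definition forgeable (x x' : sample) : bool :=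
  [exists j, (j != i) && run (orc x) (ver S vk (alpha j)
     (run (patch (U x') (orc x') (orc x)) (sign S (skey S x'.1 (orc x')) (alpha j))))].

Definition touches (D : seq fact) (x x' : sample) : bool :=
  has (fun u => (u \in T x') && (u \notin known D)) (U x).

Section Light.
Variable D : seq fact.
Hypothesis massD : 0 < mass (compatible D).
Hypothesis light : forall u, ~~ heavy D u.

Lemma light_mass u : u \notin known D ->
  mass (fun x => compatible D x && (u \in T x)) <= eps * mass (compatible D).
Proof. by move=> uD; have := light u; rewrite /heavy uD massD -ltNge => /ltW. Qed.

(* A query asked by every compatible run is heavy, hence already known; its
   answer is then the same in all compatible runs. *)
Lemma queries_known A (t : oalg A) :
  (forall x, compatible D x -> {subset queries (orc x) t <= T x}) ->
  forall x, compatible D x -> {subset queries (orc x) t <= known D}.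
Proof.
elim: t => //= l z k IH h x cx.
have zD : pt z \in known D.
  apply/negPn/negP => zD; have := light (pt z); rewrite /heavy zD massD /=.
  move=> /negP; apply; apply: (@le_trans _ _ (mass (compatible D))).
    by rewrite ler_piMl // mass_ge0.
  apply: le_mass => y cy; rewrite cy; exact: (h _ cy _ (mem_head _ _)).
move=> u; rewrite in_cons => /predU1P[-> //|]; apply: (IH _ _ x cx) => y cy w wq.
apply: (h _ cy); rewrite in_cons; apply/orP; right.
have /and3P[_ _ cx'] := cx; have /and3P[_ _ cy'] := cy.
by have /= := consistent_known cy' cx' zD; rewrite /ask /= => ->.
Qed.

(** The view fixes the key and the signature, so all compatible samples share one verification tree
    for [i] and [queries_known] applies to it. *)
Lemma ver_points_known x : compatible D x -> {subset V x i <= known D}.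
Proof.
move=> cx; have /and3P[_ /asboolP[E1 E2] _] := cx; rewrite /ver_points E1 E2.
apply: (queries_known _ cx) => y /and3P[_ /asboolP[<- <-] _] u uV.
exact: (all_points_sub (ver_points_sub uV)).
Qed.

(** The run [y] is honest in the blended oracle. Its signature comes out the same in the hybrid
    oracle used for signing, and its verification comes out the same in the real oracle. *)
Lemma good_forgeable x x' : compatible D x -> compatible D x' ->
  good S alpha x'.1 (orc (blend x x')) i ->
  ~~ touches D (blend x' x) (blend x x') -> forgeable x x'.
Proof.
move=> cx cx'; have cy := compatible_blend cx cx'.
have /and3P[_ _ Dx] := cx; have /and3P[w' /asboolP[vE' _] Dx'] := cx'.
have /and3P[_ _ Dy] := cy.
rewrite /touches blend_points => /existsP[j /andP[ji /allP gj]] /hasPn tch.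
set y := blend x x' in cy Dy gj tch *.
(* The two oracles can differ only on [U x] outside [U x']; a query of [y] located there is known,
   because the pair does not touch. *)
have aH : agree_on (T y) (orc y) (patch (U x') (orc x') (orc x)).
  move=> u uT; rewrite orc_blend !ask_patch mem_cat.
  have [ux'|ux'] := boolP (u \in U x'); first by rewrite orbT.
  rewrite orbF; case: ifP => // ux; have := tch _ ux; rewrite uT /= negbK => uD.
  exact: (consistent_known Dx' Dx uD).
have aU k : agree_on (all_points S alpha y.1 (orc y) k) (orc y) (patch (U x') (orc x') (orc x)).
  by move=> u /all_points_sub; exact: aH.
have [Es0 Ev0 _ _ _] := agree_outcome (@agree_blend x x').
apply/existsP; exists j; rewrite ji /=.
have [_ _ Esig _ _] := agree_outcome (aU j).
have sk' : skey S x'.1 (patch (U x') (orc x') (orc x)) = skey S x'.1 (orc x').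
  by have [<- _ _ _ _] := agree_outcome (aU i); rewrite Es0.
have -> : run (patch (U x') (orc x') (orc x)) (sign S (skey S x'.1 (orc x')) (alpha j)) =
    sig S alpha y.1 (orc y) j.
  by rewrite Esig /sig /= sk'.
rewrite -vE' Ev0 -[x'.1]/(y.1).
(* A verification query in [U y] belongs to the verification for [i] by goodness and is known; one
   in [U x] is known for want of touching; elsewhere the blend copies the real oracle. *)
have aV : agree_on (V y j) (orc y) (orc x).
  move=> u uV; have uT : u \in T y by apply/all_points_sub/ver_points_sub/uV.
  have uDE : u \in known D -> ask (orc y) u = ask (orc x) u.
    exact: (consistent_known Dy Dx).
  have [uU|uU] := boolP (u \in U y).
    apply: uDE; apply: (ver_points_known cy).
    by have := gj _ uV; rewrite uU.
  have [ux|ux] := boolP (u \in U x).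
    by apply: uDE; have := tch _ ux; rewrite uT /= negbK.
  rewrite orc_blend ask_patch mem_cat (negbTE ux) /=.
  by rewrite -(blend_points x x') (negbTE uU).
have [<- _] := agree_queries aV.
exact: (complete_weight _ complete).
Qed.

(** Union bound over the at most [q] points of [U x], each of which is known or light. *)
Lemma touches_mass x : compatible D x ->
  \sum_(x' | compatible D x') wt x' * (touches D x x')%:R <=
  q%:R * eps * mass (compatible D).
Proof.
move=> cx; have /and3P[wx _ _] := cx.
apply: (@le_trans _ _ (\sum_(u <- U x) eps * mass (compatible D))); last first.
  rewrite big_const_seq count_predT iter_addr_0 -[leLHS]mulr_natl -mulrA ler_wpM2r //.
    by rewrite mulr_ge0 ?mass_ge0 ?ltW.
  by rewrite ler_nat size_all_points.
apply: (@le_trans _ _ (\sum_(u <- U x) \sum_(x' | compatible D x')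
    wt x' * ((u \in T x') && (u \notin known D))%:R)).
  rewrite exchange_big /=; apply: ler_sum => x' _; rewrite -mulr_sumr.
  by rewrite ler_wpM2l ?weight_ge0 // has_le_sum.
apply: ler_sum => u _; have [uD|uD] := boolP (u \in known D).
  rewrite big1 ?mulr_ge0 ?mass_ge0 ?ltW // => x' _; by rewrite andbF mulr0.
by under eq_bigr do rewrite andbT; rewrite -mass_cond; exact: light_mass.
Qed.

(* The pairs of compatible samples carry an exchange-invariant weight, so the
   run of the fake keys against the real oracle is as good as a genuine run,
   up to the pairs that touch. *)
Lemma forgeable_pairs :
  mass (compatible D) *
    (mass (fun x => compatible D x && good S alpha x.1 (orc x) i)
     - q%:R * eps * mass (compatible D)) <=
  \sum_(x' | compatible D x')
    wt x' * mass (fun x => compatible D x && forgeable x x').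
Proof.
set C := compatible D; pose gd x := good S alpha x.1 (orc x) i.
pose F (p : sample * sample) := wt p.1 * (wt p.2 * (gd p.2 && ~~ touches D p.1 p.2)%:R).
have CE p : C (exchange p).1 && C (exchange p).2 = C p.1 && C p.2.
  have h p' : C p'.1 && C p'.2 -> C (exchange p').1 && C (exchange p').2.
    by move=> /andP[c1 c2]; apply/andP; split; exact: compatible_blend.
  by apply/idP/idP => [/h|/h//]; rewrite exchangeK.
have -> : \sum_(x' | C x') wt x' * mass (fun x => C x && forgeable x x') =
    \sum_(p | C p.1 && C p.2) wt p.1 * (wt p.2 * (forgeable p.1 p.2)%:R).
  rewrite -(pair_big C C (fun x x' => wt x * (wt x' * (forgeable x x')%:R))) /=.
  rewrite exchange_big; apply: eq_bigr => x' _; rewrite mass_cond mulr_sumr.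
  by apply: eq_bigr => x _; rewrite mulrCA.
apply: (@le_trans _ _ (\sum_(p | C p.1 && C p.2) F p)); last first.
  rewrite (reindex_inj (inv_inj exchangeK)) (eq_bigl _ _ CE).
  apply: ler_sum => -[x x'] /andP[/= cx cx'].
  rewrite /F /= !ler_wpM2l ?weight_ge0 // ler_nat.
  case: (boolP (_ && _)) => // /andP[g t]; rewrite lt0b; exact: (good_forgeable cx cx').
rewrite -(pair_big C C (fun x x' => F (x, x'))) /F /= mulr_suml; apply: ler_sum => x cx.
rewrite -mulr_sumr ler_wpM2l ?weight_ge0 // (le_trans (lerB (lexx _) (touches_mass cx))) //.
rewrite mass_cond -sumrB; apply: ler_sum => x' _; rewrite -mulrBr ler_wpM2l ?weight_ge0 //.
by rewrite -/(gd x'); case: (gd x'); case: (touches _ _ _); rewrite /= ?subrr ?subr0 ?sub0r ?lerN10.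
Qed.

(** Averaging [forgeable_pairs] over [x']: if every compatible fake run fell short, so would the
    weighted sum. *)
Lemma exists_fake : exists2 x', compatible D x' &
  mass (fun x => compatible D x && good S alpha x.1 (orc x) i)
    - q%:R * eps * mass (compatible D) <=
  mass (fun x => compatible D x && forgeable x x').
Proof.
apply: contrapT => no; have := forgeable_pairs; apply/negP; rewrite -ltNge.
set c := _ - _; rewrite /mass mulr_suml; apply: ltr_sum => [|x' cx'].
  apply/hasP; apply: contrapT => no'; move: massD; rewrite /mass big1 ?ltxx // => x cx.
  by case: no'; exists x => //; rewrite mem_index_enum.
have /and3P[wx' _ _] := cx'; rewrite ltr_pM2l // ltNge; apply/negP => h.
by apply: no; exists x'.
Qed.

End Light.

(** * The adversary: construction, query count and locality *)

Definition fake (D : seq fact) (x' : sample) : bool :=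
  compatible D x' &&
  (mass (fun x => compatible D x && good S alpha x.1 (orc x) i)
     - q%:R * eps * mass (compatible D) <=
   mass (fun x => compatible D x && forgeable x x')).

(** The index that succeeds depends on hidden parts of the real run, so each candidate is tested
    against the real oracle. The fallback output repeats [alpha i] and counts as a failure. *)
Fixpoint tryall (x' : sample) (js : seq 'I_n) : oalg (M * Sig) :=
  if js is j :: js then
    obind (override (U x') (orc x') (sign S (skey S x'.1 (orc x')) (alpha j))) (fun s =>
    obind (ver S vk (alpha j) s) (fun b =>
    if b then Ret (alpha j, s) else tryall x' js))
  else Ret (alpha i, sg).

Definition finish (D : seq fact) : oalg (M * Sig) :=
  if [pick x' | fake D x'] is Some x' then tryall x' [seq j <- enum 'I_n | j != i]
  else Ret (alpha i, sg).

(** The fuel [f] caps the number of heavy queries. Heavy points are picked by classical choice,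
    since only queries are counted as cost. *)
Fixpoint attack (f : nat) (D : seq fact) : oalg (M * Sig) :=
  if pselect (exists u, heavy D u) is left h then
    let u := projT1 (cid h) in
    if f is f.+1 then Query (tagged u) (fun a => attack f (mkfact (tagged u) a :: D))
    else Ret (alpha i, sg)
  else finish D.

Definition wins (x : sample) (res : M * Sig) : bool :=
  `[< res.1 <> alpha i >] && run (orc x) (ver S vk res.1 res.2).

Lemma forgeable_wins x x' : forgeable x x' ->
  wins x (run (orc x) (tryall x' [seq j <- enum 'I_n | j != i])).
Proof.
move=> /existsP[j /andP[ji fj]].
have : j \in [seq j <- enum 'I_n | j != i] by rewrite mem_filter ji mem_enum.
have : all (fun j => j != i) [seq j <- enum 'I_n | j != i] by exact: filter_all.
elim: [seq j <- enum 'I_n | j != i] => //= k ks IH /andP[ki aki] jk.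
rewrite run_bind run_override run_bind; case: ifP => [ok|nok]; last first.
  apply: IH => //; move: jk; rewrite in_cons => /predU1P[jE|//].
  by move: fj; rewrite jE nok.
rewrite /wins /= ok andbT; apply/asboolP => /alpha_inj kE.
by rewrite kE eqxx in ki.
Qed.

Lemma patch_keys x O : let H := patch (U x) (orc x) O in
  skey S x.1 H = skey S x.1 (orc x) /\ vkey S x.1 H = vkey S x.1 (orc x).
Proof.
have aU : agree_on (U x) (orc x) (patch (U x) (orc x) O).
  by move=> u ux; rewrite ask_patch ux.
by have [-> -> _ _ _] := agree_outcome aU.
Qed.

Lemma nqueries_tryall D x' js O : compatible D x' ->
  (nqueries O (tryall x' js) <= size js * (2 * q))%N.
Proof.
move=> /and3P[w' _ _]; elim: js => //= j js IH.
rewrite !nqueries_bind mulSn {1}mul2n -addnn -!addnA; apply: leq_add.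
  (* The patched oracle generates the same fake secret key, so the total query bound covers signing
     in it. *)
  apply: leq_trans (nqueries_override _ _ _ _) _.
  have [<- _] := patch_keys x' O; exact: nqueries_sign.
apply: leq_add; last by case: ifP.
by apply: leq_trans (verq _ _ _ _) _; lia.
Qed.

Lemma nqueries_finish D O : (nqueries O (finish D) <= n * (2 * q))%N.
Proof.
rewrite /finish; case: pickP => [x' /andP[cx' _]|//].
apply: leq_trans (nqueries_tryall _ _ cx') _; rewrite leq_mul2r; apply/orP; right.
by rewrite size_filter (leq_trans (count_size _ _)) // size_enum_ord.
Qed.

Lemma heavy_run_point D u : heavy D u ->
  exists2 x, compatible D x & u \in T x.
Proof.
move=> /and3P[_ W0 hu]; apply: contrapT => no.
have W1 : 0 < eps * mass (compatible D) by rewrite mulr_gt0.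
have := lt_le_trans W1 hu; rewrite /mass big1 ?ltxx // => x /andP[cx ux].
by case: no; exists x.
Qed.

(* For [q = 0] no query is ever heavy. *)
Lemma nqueries_attack f D O :
  (nqueries O (attack f D) <= (q != 0) * f + n * (2 * q))%N.
Proof.
elim: f => [|f IH] in D *; rewrite /=; case: pselect => [h|nh] //=.
- by rewrite (leq_trans (nqueries_finish _ _)) // leq_addl.
- have q0 : q != 0%N.
    case: (cid h) => u /= /heavy_run_point[x /and3P[wx _ _] uT].
    apply: contraTneq uT => q0; have := size_run_points alpha totq (orc x) wx.
    by rewrite q0 mul0n leqn0 size_eq0 => /eqP ->.
  by have := IH (mkfact _ (O (tag (projT1 (cid h))) (tagged (projT1 (cid h)))) :: D); rewrite q0 !mul1n addSn ltnS.
- by rewrite (leq_trans (nqueries_finish _ _)) // leq_addl.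
Qed.

(** Each algorithm called here is a stage of the experiment with coins [x'.1] in some oracle, so
    [explen] bounds its query lengths. *)
Lemma local_tryall D x' js : compatible D x' -> local N (tryall x' js).
Proof.
move=> cx'; have /and3P[_ /asboolP[vE _] _] := cx'.
elim: js => //= j js IH; have eN := explen j (ltn_ord x'.1).
apply: local_bind => [|O1].
  apply/local_override/local_maxlen; apply: leq_trans eN.
  apply: leq_trans (maxlen_bind_run (orc x') _ _); exact: maxlen_bind.
apply: local_bind => [|O2]; last by case: ifP.
apply: local_maxlen; apply: leq_trans eN; rewrite run_override.
have [E1 E2] := patch_keys x' O1; set H := patch _ _ _ in E1 E2 *.
rewrite -vE -E1 -E2.
apply: leq_trans (maxlen_bind_run H _ _).
apply: leq_trans (maxlen_bind_run H _ _); exact: maxlen_bind.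
Qed.

Lemma local_attack f D : local N (attack f D).
Proof.
have lf D' : local N (finish D').
  rewrite /finish; case: pickP => [x' /andP[cx' _]|//]; exact: local_tryall cx'.
elim: f => [|f IH] in D *; rewrite /=; case: pselect => [h|nh] //=.
apply: local_query => [|a]; last exact: IH.
case: (cid h) => u /= /heavy_run_point[x _]; apply: tag_run_points_lt => j.
exact: explen (ltn_ord x.1).
Qed.

(** Any output other than [alpha i] has already passed verification inside the attack. The winning
    event is therefore local although [N] does not bound the final verification of arbitrary
    outputs. *)
Lemma attack_sound f D O (res := run O (attack f D)) :
  res.1 = alpha i \/ run O (ver S vk res.1 res.2) = true.
Proof.
have sound_tryall x' js : let res := run O (tryall x' js) in
    res.1 = alpha i \/ run O (ver S vk res.1 res.2) = true.
  elim: js => [|j js IH] /=; first by left.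
  by rewrite !run_bind; case: ifP => //= ->; right.
have sound_finish D' : let res := run O (finish D') in
    res.1 = alpha i \/ run O (ver S vk res.1 res.2) = true.
  by rewrite /finish; case: pickP => [x' _|_] /=; [exact: sound_tryall|left].
rewrite {}/res; elim: f => [|f IH] in D *; rewrite /=; case: pselect => [h|nh] //=; by left.
Qed.

(** * Success probability of the attack *)

Lemma finish_mass D : (forall u, ~~ heavy D u) ->
  mass (fun x => compatible D x && good S alpha x.1 (orc x) i)
    - q%:R * eps * mass (compatible D) <=
  mass (fun x => compatible D x && wins x (run (orc x) (finish D))).
Proof.
move=> light; have [W0|W0] := ltP 0 (mass (compatible D)).
  rewrite /finish; case: pickP => [x' /andP[cx' h]|no]; last first.
    by have [x' cx' h] := exists_fake W0 light; have := no x'; rewrite /fake cx' h.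
  apply: (le_trans h); apply: le_mass => x /andP[-> /forgeable_wins].
  exact.
apply: (@le_trans _ _ 0); last exact: mass_ge0.
have -> : mass (compatible D) = 0 by apply/eqP; rewrite eq_le W0 mass_ge0.
rewrite mulr0 subr0; apply: le_trans W0; apply: le_mass => x /andP[]//.
Qed.

(** The potential that limits heavy queries: an unnormalised expectation of the number of distinct
    run queries still unknown. *)
Definition unknown_mass D : R :=
  \sum_(x | compatible D x) wt x * (size [seq u <- undup (T x) | u \notin known D])%:R.

Lemma compatible_split D l (z : l.-tuple bool) (F : sample -> R) :
  \sum_(x | compatible D x) F x =
  \sum_(a : l.-tuple bool) \sum_(x | compatible (mkfact z a :: D) x) F x.
Proof.
rewrite (partition_big (fun x => orc x l z) predT) //=; apply: eq_bigr => a _.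
by apply: eq_bigl => x; rewrite /compatible /= [in RHS](andbC (_ == _)) !andbA.
Qed.

Lemma unknown_mass_split D l (z : l.-tuple bool) : pt z \notin known D ->
  unknown_mass D = mass (fun x => compatible D x && (pt z \in T x)) +
    \sum_(a : l.-tuple bool) unknown_mass (mkfact z a :: D).
Proof.
move=> zD; rewrite mass_cond /unknown_mass.
rewrite -(compatible_split D z (fun x => wt x *
   (size [seq u <- undup (T x) | u \notin pt z :: known D])%:R)).
rewrite -big_split; apply: eq_bigr => x _ /=; rewrite -mulrDr -natrD; congr (_ * _%:R).
rewrite -mem_undup !size_filter -(count_uniq_mem _ (undup_uniq _)) -count_predUI.
rewrite [X in (_ + X)%N](_ : _ = 0%N) ?addn0; last first.
  apply/eqP; rewrite -[_ == _]negbK -lt0n -has_count; apply/hasPn => u _ /=.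
  by rewrite inE; case: eqP => //= ->; rewrite mem_head.
apply: eq_count => u /=; rewrite in_cons negb_or.
by case: eqVneq => // ->; rewrite zD.
Qed.

(** Markov's inequality in inductive form. A heavy query lowers the potential by at least [eps]
    times the mass, and the price [c] per unit of potential pays for the unit of fuel spent. *)
Lemma attack_mass c f D : 0 <= c -> c * eps * f%:R <= 1 ->
  mass (fun x => compatible D x && good S alpha x.1 (orc x) i)
    - q%:R * eps * mass (compatible D) - c * unknown_mass D
    - (1 - c * eps * f%:R) * mass (compatible D) <=
  mass (fun x => compatible D x && wins x (run (orc x) (attack f D))).
Proof.
move=> c0; have um0 D' : 0 <= unknown_mass D'.
  by apply: sumr_ge0 => x _; rewrite mulr_ge0 // weight_ge0.
have qe D' : 0 <= q%:R * eps * mass (compatible D').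
  by rewrite !mulr_ge0 // ?mass_ge0 // ltW.
have leaf D' f' : c * eps * f'%:R <= 1 -> (forall u, ~~ heavy D' u) ->
    mass (fun x => compatible D' x && good S alpha x.1 (orc x) i)
    - q%:R * eps * mass (compatible D') - c * unknown_mass D'
    - (1 - c * eps * f'%:R) * mass (compatible D') <=
    mass (fun x => compatible D' x && wins x (run (orc x) (finish D'))).
  move=> cf /finish_mass; apply: le_trans; rewrite -addrA gerDl -opprD oppr_le0.
  by rewrite addr_ge0 ?mulr_ge0 ?mass_ge0 ?subr_ge0.
elim: f => [|f IH] in D * => cf; rewrite /=; case: pselect => [h|nh] /=.
(* Fuel is exhausted with a heavy point left: the last term is now the full mass, so the left side
   is at most zero. *)
- apply: le_trans (mass_ge0 _); rewrite mulr0 subr0 mul1r.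
  have GW : mass (fun x => compatible D x && good S alpha x.1 (orc x) i) <=
      mass (compatible D) by apply: le_mass => x /andP[].
  have := mulr_ge0 c0 (um0 D); have := qe D; lra.
- by apply: leaf => // u; apply/negP => hu; apply: nh; exists u.
- have cf' : c * eps * f%:R <= 1.
    by apply: le_trans cf; rewrite ler_wpM2l ?ler_nat // mulr_ge0 // ltW.
  case: (cid h) => -[l z] /= hz; have /and3P[zD W0 hW] := hz.
  have -> : mass (fun x => compatible D x && wins x (run (orc x)
        (attack f (mkfact z (orc x l z) :: D)))) =
      \sum_(a : l.-tuple bool) mass (fun x => compatible (mkfact z a :: D) x &&
         wins x (run (orc x) (attack f (mkfact z a :: D)))).
    rewrite mass_cond (compatible_split D z); apply: eq_bigr => a _.
    rewrite mass_cond; apply: eq_bigr => x /and3P[_ _ /andP[/eqP /= E _]].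
    by rewrite E.
  have le := @ler_sum R _ (index_enum {: l.-tuple bool}) xpredT _ _
    (fun a _ => IH (mkfact z a :: D) cf').
  apply: le_trans le; rewrite !sumrB -!mulr_sumr.
  have Wsplit : \sum_(a : l.-tuple bool) mass (compatible (mkfact z a :: D)) =
      mass (compatible D) by rewrite /mass -compatible_split.
  have Gsplit : \sum_(a : l.-tuple bool) mass (fun x => compatible (mkfact z a :: D) x &&
        good S alpha x.1 (orc x) i) =
      mass (fun x => compatible D x && good S alpha x.1 (orc x) i).
    rewrite mass_cond (compatible_split D z); apply: eq_bigr => a _.
    by rewrite mass_cond.
  rewrite Wsplit Gsplit (unknown_mass_split zD) -natr1.
  have := ler_wpM2l c0 hW; lra.
- by apply: leaf => // u; apply/negP => hu; apply: nh; exists u.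
Qed.

End View.

(** Views live in arbitrary types, so the sum is split by a representative sample of each view
    instead of by the view itself. *)
Lemma sum_by_view (F : sample -> R) :
  (forall vk sg, 0 <= \sum_(x | compatible vk sg [::] x) F x) ->
  0 <= \sum_(x | 0 < wt x) F x.
Proof.
move=> h; pose view x := (vkey S x.1 (orc x), sig S alpha x.1 (orc x) i).
pose P x y := (0 < wt y) && `[< view y = view x >].
pose rep x := odflt x [pick y | P x y].
have repP x : 0 < wt x -> P x (rep x).
  move=> wx; rewrite /rep; case: pickP => [y //|/(_ x)] /=.
  by rewrite /P wx asboolT.
have repE x y : 0 < wt x -> view x = view y -> rep x = rep y.
  move=> wx E; have PE : P x =1 P y by move=> z; rewrite /P E.
  rewrite /rep (eq_pick PE); case: pickP => //= /(_ x).
  by rewrite /P wx asboolT.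
rewrite (partition_big rep (fun y => rep y == y)) /=; last first.
  move=> x wx; have /andP[w' /asboolP E] := repP _ wx.
  by apply/eqP; exact: repE.
apply: sumr_ge0 => y /eqP ry.
have := h (view y).1 (view y).2; congr (0 <= _); apply: eq_bigl => x.
rewrite /compatible andbT; have [wx|//] := boolP (0 < wt x); rewrite /=.
apply/asboolP/eqP => [[E1 E2]|E].
  by rewrite -ry; apply: repE => //; rewrite /view E1 E2.
have /andP[_ /asboolP] := repP _ wx; rewrite E => /esym E'.
by move: (congr1 fst E') (congr1 snd E').
Qed.

(** The choice [c * eps * f = 1] cancels the fuel term, and the initial potential is at most [q * n]
    times the mass. *)
Lemma attack_wins c f : 0 <= c -> c * eps * f%:R = 1 ->
  mass (fun x => (0 < wt x) && good S alpha x.1 (orc x) i)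
    - (q%:R * eps + c * (q * n)%:R) * mass (fun x => 0 < wt x) <=
  mass (fun x => (0 < wt x) && wins (vkey S x.1 (orc x)) x
    (run (orc x) (attack (vkey S x.1 (orc x)) (sig S alpha x.1 (orc x) i) f [::]))).
Proof.
move=> c0 cf; rewrite -subr_ge0 !mass_cond /mass mulr_sumr -!sumrB.
apply: sum_by_view => vk sg; rewrite !sumrB -mulr_sumr -!mass_cond.
have cf1 : c * eps * f%:R <= 1 by rewrite cf.
have := attack_mass vk sg [::] c0 cf1; rewrite cf subrr mul0r subr0.
have um : unknown_mass vk sg [::] <= (q * n)%:R * mass (compatible vk sg [::]).
  rewrite /mass mulr_sumr; apply: ler_sum => x /andP[wx _].
  rewrite mulrC ler_wpM2r ?weight_ge0 // ler_nat size_filter.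
  rewrite (leq_trans (count_size _ _)) // (leq_trans (size_undup _)) //.
  exact: size_run_points.
rewrite (_ : mass (fun x => compatible vk sg [::] x && wins vk x _) =
  mass (fun x => compatible vk sg [::] x && wins (vkey S x.1 (orc x)) x
   (run (orc x) (attack (vkey S x.1 (orc x)) (sig S alpha x.1 (orc x) i) f [::])))).
  by have := ler_wpM2l c0 um; rewrite -/(mass _); lra.
by rewrite !mass_cond; apply: eq_bigr => x /and3P[_ /asboolP[-> ->] _].
Qed.

End Attack.

(** * From finite samples to the probability of a break *)

Section BreakProbability.
Local Open Scope classical_set_scope.
Local Open Scope ring_scope.
Variables (R : realType) (M SK VK Sig : Type) (S : scheme R M SK VK Sig).

Lemma sum_weight K : (\sum_(r < K) weight S r)%:E = gen_coins S `I_K.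
Proof.
transitivity (gen_coins S (\bigcup_(r in [set r : 'I_K | true]) [set (r : nat)])).
  rewrite measure_finType_bigcup // => [|r r' _ _ [k [/= -> E]]]; last exact: val_inj.
  by rewrite -sumEFin; apply: eq_bigr => r _; exact/esym/weightE.
congr (gen_coins S _); apply/seteqP; split=> [k [r _ /= ->] //=|k /= kK].
by exists (Ordinal kK).
Qed.

Lemma sum_weight_le1 K : \sum_(r < K) weight S r <= 1.
Proof. by rewrite -lee_fin sum_weight probability_le1. Qed.

(** Continuity from below along initial segments; it makes the set of coins finite at a cost of
    [eta]. *)
Lemma exists_coin_bound (eta : R) : 0 < eta ->
  exists K, 1 - eta <= \sum_(r < K) weight S r.
Proof.
move=> eta0.
have cv : (gen_coins S \o (fun k => `I_k)) @ \oo --> 1%E.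
  have UI : \bigcup_k `I_k = [set: nat] by apply/seteqP; split=> // k _; exists k.+1 => /=.
  rewrite -(probability_setT (gen_coins S)) -UI.
  apply: nondecreasing_cvg_mu => // k k' kk'; apply/subsetPset => r /= rk.
  exact: leq_trans kk'.
have : \forall k \near \oo, ((1 - eta)%:E < gen_coins S `I_k)%E.
  have lt1 : ((1 - eta)%:E < 1%E)%E by rewrite lte_fin ltrBlDr ltrDl.
  exact: (cv [set u | (1 - eta)%:E < u]%E (open_ereal_gt' lt1)).
move=> [k _ /(_ k (leqnn k)) /= h]; exists k.
by rewrite -lee_fin sum_weight ltW.
Qed.

Variables (A : adversary R M VK Sig) (P : probability oracleM R).

(** The whole attack game as one decision tree, so that [maxlen] yields measurability of the winning
    event. *)
Definition game (s r : nat) : oalg Prop :=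
  obind (gen S r) (fun kp =>
  obind (sign S kp.1 (adv_msg A s)) (fun sg =>
  obind (adv_forge A s kp.2 sg) (fun o =>
  obind (ver S kp.2 o.1 o.2) (fun b =>
  Ret (o.1 <> adv_msg A s /\ b = true))))).

Lemma run_game s r O : run O (game s r) = breaks S A s r O.
Proof.
rewrite /game /breaks run_bind; case: (run O (gen S r)) => sk vk /=.
by rewrite !run_bind; case: (run O (adv_forge _ _ _ _)) => m sg.
Qed.

Lemma measurable_breaks s r : measurable ([set O | breaks S A s r O] : set oracleM).
Proof.
apply: (@measurable_local_event (maxlen (game s r))) => O O' h /=.
by rewrite -!run_game (local_maxlen (leqnn _) h).
Qed.

(** The winning event contains disjoint measurable rectangles, one for each [r < K]. *)
Lemma break_prob_ge K : adv_coins A = dirac 0%N ->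
  (\sum_(r < K) (weight S r)%:E * P [set O | breaks S A 0%N r O] <=
   break_prob S A P)%E.
Proof.
move=> A0.
pose m2 : probability (nat * oracleM)%type R := (gen_coins S \x P)%E.
pose mu : probability (nat * (nat * oracleM))%type R := (adv_coins A \x m2)%E.
pose B s r := [set O : oracleM | breaks S A s r O].
pose F s r := [set s] `*` ([set r] `*` B s r).
have mF s r : measurable (F s r).
  by apply: measurableX => //; apply: measurableX => //; exact: measurable_breaks.
have mE : measurable [set w : nat * (nat * oracleM) | breaks S A w.1 w.2.1 w.2.2].
  rewrite (_ : [set w | _] = \bigcup_s \bigcup_r F s r).
    by do 2!apply: bigcupT_measurable => ?.
  apply/seteqP; split=> [[s [r f]] /= h|[s [r f]] /= [s' _ [r' _ [/= -> [-> ]]]] //].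
  by exists s => //; exists r.
apply: (@le_trans _ _ (mu
    (\bigcup_(r in [set r : 'I_K | true]) F 0%N r))%E); last first.
  apply: (@le_measure _ _ _ mu); rewrite ?inE //.
    by apply: fin_bigcup_measurable => [|r _ //]; exact: finite_finset.
  by move=> [s [r f]] /= [r' _ [/= -> [-> ]]].
rewrite measure_finType_bigcup //; last first.
  by move=> r r' _ _ [[s [k f]] [[_ [/= -> _]] [_ [/= E _]]]]; exact: val_inj.
apply: lee_sum => r _; rewrite [leRHS]product_measure1E //; last first.
  by apply: measurableX => //; exact: measurable_breaks.
rewrite [X in (_ <= X * _)%E](_ : _ = 1%E); last by rewrite A0 /= diracE mem_set.
rewrite mul1e [leRHS]product_measure1E //; last exact: measurable_breaks.
by rewrite -weightE.
Qed.

End BreakProbability.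

(** * Choice of the signed message *)

Section Averaging.
Local Open Scope ring_scope.
Variables (R : realType) (M SK VK Sig : Type) (S : scheme R M SK VK Sig).
Variables (n : nat) (alpha : 'I_n -> M) (q v K N : nat).
Hypothesis totq : total_queries_le S q.
Hypothesis verq : ver_queries_le S v.
Hypothesis vq : (2 * v <= q)%N.

(** Each sample of positive weight has at most ['C(q, v) <= lambda * n] bad indices; summing over
    samples first, some index does at least as well as the average. *)
Lemma exists_message (lambda : R) : (0 < n)%N -> 'C(q, v)%:R <= lambda * n%:R ->
  exists i : 'I_n, (1 - lambda) * mass S (fun x : 'I_K * tables N => 0 < weight S x.1) <=
   mass S (fun x : 'I_K * tables N => (0 < weight S x.1) && good S alpha x.1 (extend x.2) i).
Proof.
move=> n0 Cn; apply: contrapT => no.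
set W := mass S _ in no; 
pose G i := mass S (fun x : 'I_K * tables N =>
  (0 < weight S x.1) && good S alpha x.1 (extend x.2) i).
have lt : \sum_i G i < \sum_(i < n) (1 - lambda) * W.
  apply: ltr_sum => [|i _].
    by apply/hasP; exists (Ordinal n0) => //; rewrite mem_index_enum.
  by rewrite ltNge; apply/negP => h; apply: no; exists i.
have : \sum_i G i < \sum_i G i; last by rewrite ltxx.
apply: (lt_le_trans lt); rewrite sumr_const card_ord -mulr_natl.
have -> : \sum_i G i = \sum_(x : 'I_K * tables N | 0 < weight S x.1)
    weight S x.1 * #|[set i | good S alpha x.1 (extend x.2) i]|%:R.
  rewrite /G; under eq_bigr do rewrite mass_cond.
  rewrite exchange_big; apply: eq_bigr => x _ /=; rewrite -mulr_sumr -sum1_card natr_sum.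
  congr (_ * _); rewrite [RHS]big_mkcond; apply: eq_bigr => i _ /=.
  by rewrite inE; case: good.
rewrite mulrCA /W /mass mulrA mulr_sumr; apply: ler_sum => x wx.
rewrite mulrC ler_wpM2l ?weight_ge0 //.
apply: (@le_trans _ _ (n%:R - 'C(q, v)%:R)); first by lra.
have bad := card_bad alpha totq verq vq (extend x.2) wx.
rewrite lerBlDr -natrD ler_nat.
have := cardsC [set i | good S alpha x.1 (extend x.2) i]; rewrite card_ord => {1}<-.
rewrite leq_add2l (leq_trans _ bad) // subset_leq_card //.
by apply/fintype.subsetP => i; rewrite !inE.
Qed.

End Averaging.

Lemma card_le_inj (M : Type) (n : nat) : (`I_n #<= [set: M])%card ->
  exists alpha : 'I_n -> M, injective alpha.
Proof.
move=> /card_leP[f].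
have mI (j : 'I_n) : (j : nat) \in `I_n by rewrite mem_set //= ltn_ord.
pose idx (j : 'I_n) := exist (fun x : nat => is_true (x \in `I_n)) (j : nat) (mI j).
exists (fun j => proj1_sig (f (idx j))) => j k E.
have : f (idx j) = f (idx k).
  move: E; case: (f _) => a ha; case: (f _) => b hb /= E.
  by case: _ / E in hb *; rewrite (bool_irrelevance ha hb).
move/(@inj _ _ _ f); rewrite !in_setT => /(_ isT isT) [E'].
exact: val_inj.
Qed.

(** * Parameters and assembly *)

Section Main.
Local Open Scope ring_scope.
Variables (R : realType) (P : probability oracleM R).
Hypothesis roP : random_oracle P.
Variables (M SK VK Sig : Type) (S : scheme R M SK VK Sig) (q v : nat).
Hypothesis complete : perfectly_complete S.
Hypothesis totq : total_queries_le S q.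
Hypothesis verq : ver_queries_le S v.
Hypothesis vq : (2 * v <= q)%N.

(** Disposes of [1 - lambda - delta <= 0], after which both parameters are below one. *)
Lemma trivial_adversary (m : M) (p B : R) : p <= 0 -> 0 <= B ->
  exists A : adversary R M VK Sig, adv_queries_le A B /\ (p%:E <= break_prob S A P)%E.
Proof.
move=> p0 B0; exists (Adversary (dirac 0%N) (fun=> m) (fun _ _ sg => Ret (m, sg))).
split=> //; apply: (@le_trans _ _ 0%E); first by rewrite lee_fin.
pose m2 : probability (nat * oracleM)%type R := (gen_coins S \x P)%E.
pose mu : probability (nat * (nat * oracleM))%type R := (dirac 0%N \x m2)%E.
exact: (@measure_ge0 _ _ _ mu).
Qed.

Section FixedMessages.
Variables (n : nat) (alpha : 'I_n -> M) (lambda delta : R) (f : nat).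
Hypothesis alpha_inj : injective alpha.
Hypothesis n_gt0 : (0 < n)%N.
Hypothesis lambda_gt0 : 0 < lambda.
Hypothesis Cn : 'C(q, v)%:R <= lambda * n%:R.
Hypothesis delta_gt0 : 0 < delta.
Hypothesis delta_lt1 : delta < 1.
Hypothesis f_gt0 : (0 < f)%N.
Hypothesis f_ge : 16 * (q%:R * (q%:R + 1) * n%:R) <= delta ^+ 2 * f%:R.

Lemma exists_adversary : exists A : adversary R M VK Sig,
  (forall O s vk sg, (nqueries O (adv_forge A s vk sg) <= (q != 0) * f + n * (2 * q))%N) /\
  ((1 - lambda - delta)%:E <= break_prob S A P)%E.
Proof.
have [K omega_ge] : exists K, 1 - delta / 4 <= \sum_(r < K) weight S r.
  by apply: exists_coin_bound; rewrite divr_gt0.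
have omega_le := sum_weight_le1 S K.
set omega := \sum_(r < K) _ in omega_ge omega_le.
pose N := (\max_(r < K) \max_(j < n) maxlen (experiment S alpha r j))%N.
have explen r j : (r < K)%N -> (maxlen (experiment S alpha r j) <= N)%N.
  move=> rK; apply: leq_trans (leq_bigmax (Ordinal rK)).
  exact: (leq_bigmax (F := fun j => maxlen (experiment S alpha r j))).
have [i Gi] := exists_message alpha K N totq verq vq n_gt0 Cn.
have q1 : 0 < 4 * (q%:R + 1) :> R by rewrite mulr_gt0 // ltr_wpDl.
(* Truncating the coins, touching pairs and running out of fuel each cost at most [delta / 4]. The
   second needs [q * eps <= delta / 4], with [q + 1] covering [q = 0]; for this [eps] the third is
   exactly [f_ge]. *)
have [eps eps_gt0 epsE] : exists2 eps : R, 0 < eps & eps * (4 * (q%:R + 1)) = delta.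
  exists (delta / (4 * (q%:R + 1))); first by rewrite divr_gt0.
  by rewrite divfK // gt_eqF.
have q0 : 0 <= q%:R :> R by [].
have eq0 := mulr_ge0 q0 (ltW eps_gt0).
have epsD : 4 * (q%:R * eps) + 4 * eps = delta by rewrite -epsE; ring.
have eps_le1 : eps <= 1 by move: delta_lt1; lra.
have f0 : 0 < f%:R :> R by rewrite ltr0n.
pose c := (eps * f%:R)^-1.
have c0 : 0 <= c by rewrite invr_ge0 mulr_ge0 // ltW.
have cf : c * eps * f%:R = 1 by rewrite -mulrA mulVf // mulf_neq0 // gt_eqF.
have := attack_wins K N alpha_inj complete totq i eps_gt0 eps_le1 c0 cf.
set Win := (X in _ <= X) => win.
have qe : q%:R * eps <= delta / 4 by lra.
have cq : c * (q * n)%:R <= delta / 4.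
  rewrite /c mulrC ler_pdivrMr ?mulr_gt0 // natrM.
  rewrite -(ler_pM2r q1).
  have -> : delta / 4 * (eps * f%:R) * (4 * (q%:R + 1)) = delta / 4 * f%:R * delta.
    by rewrite -epsE; field.
  by move: f_ge; lra.
pose tn : R := #|{: tables N}|%:R.
have tn0 : 0 < tn.
  by rewrite ltr0n; apply/card_gt0P; exists (truncate N (fun l => [ffun x => x])).
have massE : mass S (fun x : 'I_K * tables N => 0 < weight S x.1) = tn * omega.
  rewrite /mass big_mkcond -(pair_big xpredT xpredT
    (fun (r : 'I_K) (w : tables N) => if 0 < weight S r then weight S r else 0)) /=.
  rewrite /omega mulr_sumr; apply: eq_bigr => r _; rewrite sumr_const -mulr_natl.
  have := weight_ge0 S r; rewrite le_eqVlt => /predU1P[<-|->//].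
  by rewrite ltxx mulr0.
pose A : adversary R M VK Sig := Adversary (dirac 0%N) (fun=> alpha i)
  (fun _ vk sg => attack S alpha q K N i eps vk sg f [::]).
exists A; split=> [g s vk sg|]; first exact: nqueries_attack.
have lev (r : 'I_K) : local_event N [set O | breaks S A 0%N r O]%classic.
  move=> O O' h /=; rewrite /breaks.
  have eN := explen r i (ltn_ord r).
  have -> : run O' (gen S r) = run O (gen S r).
    apply/esym; apply: (local_maxlen _ h); apply: leq_trans eN; exact: maxlen_bind.
  have gE : (maxlen (sign S (run O (gen S r)).1 (alpha i)) <= N)%N.
    apply: leq_trans eN; apply: leq_trans (maxlen_bind_run O _ _).
    exact: maxlen_bind.
  move: gE; case: (run O (gen S r)) => sk vk /= gE.
  rewrite -(local_maxlen gE h); set sg := run O (sign S sk (alpha i)).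
  have := @attack_sound _ _ _ _ _ S _ alpha q K N i eps vk sg f [::] O'.
  rewrite /= -(local_attack q explen i eps_gt0 vk sg f [::] h).
  by case: (run O (attack _ _ _ _ _ _ _ _ _ _ _)) => m s /= [-> [] //|ok [nm _]].
apply: (le_trans _ (break_prob_ge S P K (erefl : adv_coins A = dirac 0%N))).
have -> : (\sum_(r < K) (weight S r)%:E * P [set O | breaks S A 0%N r O]%classic)%E =
    (tn^-1 * \sum_(x : 'I_K * tables N) weight S x.1 *
       (`[< breaks S A 0%N x.1 (extend x.2) >])%:R)%:E.
  rewrite -(pair_big xpredT xpredT (fun (r : 'I_K) (w : tables N) => weight S r *
       (`[< breaks S A 0%N r (extend w) >])%:R)) /= mulr_sumr -sumEFin.
  apply: eq_bigr => r _; rewrite (local_event_prob roP (lev r)) -EFinM.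
  by rewrite mulrCA mulr_sumr.
have winle : Win <= \sum_(x : 'I_K * tables N) weight S x.1 *
       (`[< breaks S A 0%N x.1 (extend x.2) >])%:R.
  rewrite /Win mass_cond big_mkcond; apply: ler_sum => x _.
  have wb : wins S alpha i (vkey S x.1 (extend x.2)) x (run (extend x.2)
      (attack S alpha q K N i eps (vkey S x.1 (extend x.2))
        (sig S alpha x.1 (extend x.2) i) f [::])) -> breaks S A 0%N x.1 (extend x.2).
    rewrite /wins /breaks /= /sig /vkey /skey; case: (run _ (gen S x.1)) => sk vk /=.
    case: (run _ (attack _ _ _ _ _ _ _ _ _ _ _)) => m s /= /andP[nm ok].
    by split=> //; apply/asboolP.
  case: ifP => [wx|_]; last by rewrite mulr_ge0 ?weight_ge0.
  rewrite ler_wpM2l ?weight_ge0 // ler_nat.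
  case: asboolP => [_|nb]; first by rewrite leq_b1.
  by rewrite leqn0 eqb0; apply/negP => /wb.
rewrite lee_fin; apply: (@le_trans _ _ (tn^-1 * Win)); last first.
  by rewrite ler_wpM2l // invr_ge0 ltW.
have := le_trans (lerB Gi (lexx _)) win.
rewrite massE -mulrBl mulrCA => h.
have : (1 - lambda - (q%:R * eps + c * (q * n)%:R)) * omega <= tn^-1 * Win.
  by rewrite -(ler_pM2l tn0) [leRHS]mulrA mulfV ?mul1r ?gt_eqF.
apply: le_trans.
have c1 : 0 <= c * (q * n)%:R by rewrite mulr_ge0.
(* Replacing the factor [omega] by one costs at most [1 - omega], because the subtracted errors are
   nonnegative. *)
have : 0 <= (lambda + (q%:R * eps + c * (q * n)%:R)) * (1 - omega).
  by rewrite mulr_ge0 ?subr_ge0 // !addr_ge0 // ltW.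
move: delta_gt0 qe cq omega_ge; set a := q%:R * eps; set b := c * _; lra.
Qed.

End FixedMessages.

End Main.

Local Open Scope ring_scope.

Theorem theorem6p11 (R : realType) :
  exists C : R,
    forall (P : probability oracleM R), random_oracle P ->
    forall (M SK VK Sig : Type) (S : scheme R M SK VK Sig) (q v : nat)
           (lambda delta : R),
      perfectly_complete S ->
      total_queries_le S q ->
      ver_queries_le S v ->
      (2 * v <= q)%N ->
      0 < lambda -> 0 < delta ->
      card_at_least M ('C(q, v)%:R / lambda) ->
      exists A : adversary R M VK Sig,
        adv_queries_le A
          (C * (q%:R ^+ 2 * 'C(q, v)%:R / (lambda * delta ^+ 2))) /\
        ((1 - lambda - delta)%:E <= break_prob S A P)%E.
Proof.
(* With [Z = q^2 X D], where [X = C / lambda] and [D = 1 / delta^2], the fuel is at most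
   [64 Z + 1 <= 65 Z] and the final phase asks at most [4 Z] queries; 70 rounds up the sum. *)
exists 70 => P roP M SK VK Sig S q v lambda delta complete totq verq vq l0 d0 [n0 n0C In0].
set C := 'C(q, v)%:R.
have C1 : 1 <= C by rewrite ler1n bin_gt0; lia.
have Cl0 : 0 < C / lambda by rewrite divr_gt0 // (lt_le_trans ltr01).
have n0_gt0 : (0 < n0)%N by rewrite -(ltr0n R); apply: lt_le_trans n0C.
have B0 : 0 <= 70 * (q%:R ^+ 2 * C / (lambda * delta ^+ 2)).
  by rewrite mulr_ge0 // divr_ge0 // mulr_ge0 ?sqr_ge0 ?(ltW l0) // (le_trans ler01).
have [alpha0 alpha0_inj] := card_le_inj In0.
have [ld|ld] := leP (1 - lambda - delta) 0.
  exact: trivial_adversary (alpha0 (Ordinal n0_gt0)) _ _ ld B0.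
(* The given [n0] may be far too large for the query bound; the least admissible [n] is at most
   [2 C / lambda], since [C / lambda >= 1]. *)
have exn : exists k, C / lambda <= k%:R by exists n0.
case: (ex_minnP exn) => n nC nmin.
have nn0 : (n <= n0)%N by exact: nmin.
have n_gt0 : (0 < n)%N by rewrite -(ltr0n R); apply: lt_le_trans nC.
have n_le : n%:R <= 2 * (C / lambda).
  have : n.-1%:R < C / lambda.
    by rewrite ltNge; apply/negP => /nmin; rewrite -ltnS prednK // ltnn.
  have : 1 <= C / lambda by rewrite ler_pdivlMr // mul1r; apply: le_trans C1; lra.
  by rewrite -{2}(prednK n_gt0) -natr1; lra.
pose alpha (j : 'I_n) := alpha0 (widen_ord nn0 j).
have alpha_inj : injective alpha.
  by move=> j k /alpha0_inj /(congr1 val) /= /val_inj.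
pose y := 16 * (q%:R * (q%:R + 1) * n%:R) / delta ^+ 2.
have y0 : 0 <= y by rewrite !mulr_ge0 ?invr_ge0 ?sqr_ge0 ?addr_ge0.
pose f := (Num.truncn y).+1.
have /andP[f_le f_ge] := truncn_itv y0.
have d2 : 0 < delta ^+ 2 by rewrite exprn_gt0.
have [A [Aq Ap]] : exists A : adversary R M VK Sig,
    (forall O s vk sg, (nqueries O (adv_forge A s vk sg) <=
       (q != 0) * f + n * (2 * q))%N) /\
    ((1 - lambda - delta)%:E <= break_prob S A P)%E.
  apply: (exists_adversary roP complete totq verq vq alpha_inj) => //.
  - by rewrite mulrC -ler_pdivrMr.
  - by lra.
  - by rewrite [leRHS]mulrC -ler_pdivrMr // ltW.
exists A; split=> // O s vk sg.
apply: (@le_trans _ _ ((q != 0) * f + n * (2 * q))%N%:R); first by rewrite ler_nat.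
(* For [q = 0] the claimed bound is zero, which the factor [(q != 0)] meets; otherwise [q >= 1]
   absorbs the lower-order terms. *)
have [q0|q0] := eqVneq q 0%N; first by apply: le_trans B0; rewrite q0 !muln0 addn0 /= mul0n.
rewrite mul1n natrD natrM natrM.
have q1 : 1 <= q%:R :> R by rewrite ler1n lt0n.
pose X := C / lambda; pose D := (delta ^+ 2)^-1.
have -> : 70 * (q%:R ^+ 2 * C / (lambda * delta ^+ 2)) = 70 * (q%:R ^+ 2 * X * D).
  by rewrite /X /D invfM !mulrA.
have X1 : 1 <= X by rewrite ler_pdivlMr // mul1r; apply: le_trans C1; lra.
have D1 : 1 <= D.
  by rewrite -invr1 lef_pV2 ?posrE // expr_le1 ?ltW //; lra.
have qq : q%:R <= q%:R ^+ 2 :> R by rewrite expr2 ler_peMl // ltW // (lt_le_trans ltr01).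
have q2 : 1 <= q%:R ^+ 2 :> R by exact: le_trans qq.
have X0 : 0 <= X by exact: le_trans X1.
have D0 : 0 <= D by exact: le_trans D1.
have Xq : q%:R * X <= q%:R ^+ 2 * X * D.
  apply: (@le_trans _ _ (q%:R ^+ 2 * X)); first by rewrite ler_wpM2r.
  by rewrite ler_peMr // mulr_ge0 // sqr_ge0.
have Z1 : 1 <= q%:R ^+ 2 * X * D by apply: le_trans Xq; rewrite mulr_ege1.
have yle : y <= 64 * (q%:R ^+ 2 * X * D).
  have -> : 64 * (q%:R ^+ 2 * X * D) = 16 * (2 * q%:R ^+ 2 * (2 * X)) * D by ring.
  rewrite /y ler_wpM2r // ler_wpM2l // ler_pM // ?mulr_ge0 ?addr_ge0 //.
  by rewrite mulrDr -expr2 mulr1 mulr2n mulrDl mul1r lerD2l.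
have nq : n%:R * (2 * q%:R) <= 4 * (q%:R * X) :> R.
  have -> : 4 * (q%:R * X) = 2 * X * (2 * q%:R) by ring.
  by rewrite ler_wpM2r // mulr_ge0.
rewrite /f -natr1; move: Xq Z1 yle nq f_le; set Z := q%:R ^+ 2 * X * D; lra.
Qed.
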